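(* Let $\mathscr T$ be the category of finitely generated free $\mathbb Z/4$-modules and let $\Sigma\colon\mathscr T\to\mathscr T$ be the identity functor. Then the edge morphism $$H^{3,-1}(\mathscr T_\Sigma,\mathscr T_\Sigma)\longrightarrow H^{0,-1}(\operatorname{mod}(\mathscr T_\Sigma),\operatorname{Ext}^{3,*}_{\mathscr T_\Sigma})$$ of the spectral sequence $E_2^{p,q}=H^{p,*}(\operatorname{mod}(\mathscr T_\Sigma),\operatorname{Ext}^{q,*}_{\mathscr T_\Sigma})\Rightarrow H^{p+q,*}(\mathscr T_\Sigma,\mathscr T_\Sigma)$ described in the context is trivial.
   Context: The ground ring is $\mathbb Z$; ''graded'' means $\mathbb Z$-graded with the Koszul sign rule; essentially small categories are replaced by small ones. For an additive category $\mathscr T$ with automorphism $\Sigma$, $\mathscr T_\Sigma$ is the graded linear category with the objects of $\mathscr T$, $\mathscr T_\Sigma^n(X,Y)=\mathscr T(X,\Sigma^nY)$, composition $fg:=(\Sigma^qf)g$ for $f$ of degree $p$, $g$ of degree $q$. $\operatorname{mod}(\mathscr T_\Sigma)$ is the graded category of finitely presented graded right $\mathscr T_\Sigma$-modules with morphisms of all degrees, and $\operatorname{Ext}^{q,*}_{\mathscr T_\Sigma}$ are the derived functors of graded Hom. Non-additive cohomology $H^{\star,*}(\mathscr C,M)=HH^{\star,*}(\mathbb Z\mathscr C,M)$ of a graded category $\mathscr C$ with coefficients in a bimodule $M$ (contravariant in the first variable) is the cohomology of the complex of families of (not necessarily multilinear) homogeneous maps of graded sets $\varphi\colon\mathscr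 C(X_1,X_0)\times\cdots\times\mathscr C(X_n,X_{n-1})\to M(X_n,X_0)$, defined on tuples of homogeneous elements, with $d(\varphi)(f_1,\dots,f_{n+1})=(-1)^{|\varphi||f_1|}f_1\cdot\varphi(f_2,\dots)+\sum_{i=1}^n(-1)^i\varphi(\dots,f_if_{i+1},\dots)+(-1)^{n+1}\varphi(f_1,\dots,f_n)\cdot f_{n+1}$. The second superscript is the internal degree. Spectral sequence: that of the bicomplex $C^{p,q}$ of families of maps of graded sets $\prod_{i=1}^p\operatorname{Hom}^*_{\mathscr T_\Sigma}(M_i,M_{i-1})\times M_p(X_0)\times\prod_{j=1}^q\mathscr T_\Sigma(X_j,X_{j-1})\to M_0(X_q)$, indexed by objects $M_i$ of $\operatorname{mod}(\mathscr T_\Sigma)$ and $X_j$ of $\mathscr T_\Sigma$, taking first vertical and then horizontal cohomology, with $d_h(\varphi)(g_1,\dots,g_{p+1},x,f_1,\dots,f_q)=(-1)^{|\varphi||g_1|}g_1(\varphi(g_2,\dots,g_{p+1},x,f_1,\dots,f_q))+\sum_{i=1}^p(-1)^i\varphi(\dots,g_ig_{i+1},\dots,x,f_1,\dots,f_q)+(-1)^{p+1}\varphi(g_1,\dots,g_p,g_{p+1}(x),f_1,\dots,f_q)$, $d_v(\varphi)(g_1,\dots,g_p,x,f_1,\dots,f_{q+1})=\varphi(g_1,\dots,g_p,x\cdot f_1,\dots,f_{q+1})+\sum_{i=1}^q(-1)^i\varphi(g_1,\dots,g_p,x,\dots,f_if_{i+1},\dots)+(-1)^{q+1}\varphi(g_1,\dots,g_p,x,f_1,\dots,f_q)\cdot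 f_{q+1}$. The vertical complex computes $\operatorname{Ext}^{q,*}_{\mathscr T_\Sigma}$, and the cohomology of the total complex is identified with $H^{*,*}(\mathscr T_\Sigma,\mathscr T_\Sigma)$ via the quasi-isomorphism $\xi(\varphi)(M)(x,f_1,\dots,f_n)=(-1)^{|\varphi||x|}x\cdot\varphi(f_1,\dots,f_n)$. Thus the edge morphism sends the class of a $3$-cocycle $m$ to the family, indexed by $M$, of the classes of $\xi(m)(M)$ in $\operatorname{Ext}^{3,*}_{\mathscr T_\Sigma}(M,M)$. *)

(* Defs.v *)
From HB Require Import structures.
From mathcomp Require Import all_boot all_order all_algebra.
From mathcomp Require Import boolp ring_quotient.

Set Implicit Arguments.
Unset Strict Implicit.
Unset Printing Implicit Defensive.

Import GRing.Theory.
Local Open Scope ring_scope.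
Local Open Scope quotient_scope.

(******************************************************************************)
(* Conventions.                                                               *)
(*                                                                            *)
(* A graded abelian group is a family of zmodTypes indexed by int.  To avoid  *)
(* transports along equations between degrees, a graded operation takes the   *)
(* degree t of its result as an argument, with an equation e (for instance    *)
(* e : p + q = t) certifying it.  Such equations are irrelevant, since int    *)
(* has decidable equality.                                                    *)
(*                                                                            *)
(* fg is the composite "f after g", and mcomp e f g stands for fg.            *)
(******************************************************************************)

Lemma int_irr (p q : int) (e e' : p = q) : e = e'.
Proof. exact: eq_irrelevance. Qed.

Lemma morphD_zmod (U V : zmodType) (f : U -> V) :
  {morph f : x y / x + y} -> zmod_morphism f.
Proof.
move=> fD x y; have f0 : f 0 = 0 by apply: (addrI (f 0)); rewrite -fD !addr0.
suff fN : f (- y) = - f y by rewrite fD fN.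
by apply: (addrI (f y)); rewrite -fD !subrr.
Qed.

Section DependentFunctions.
Variables (I : Type) (V : I -> zmodType).

Definition dfun : Type := forall i, V i.
Implicit Types f g h : dfun.

HB.instance Definition _ := gen_eqMixin dfun.
HB.instance Definition _ := gen_choiceMixin dfun.

Definition dfun0 : dfun := fun i => 0.
Definition dfunN f : dfun := fun i => - f i.
Definition dfunD f g : dfun := fun i => f i + g i.

Fact dfunA : associative dfunD.
Proof. by move=> f g h; apply: functional_extensionality_dep => i; apply: addrA. Qed.
Fact dfunC : commutative dfunD.
Proof. by move=> f g; apply: functional_extensionality_dep => i; apply: addrC. Qed.
Fact dfun0D : left_id dfun0 dfunD.
Proof. by move=> f; apply: functional_extensionality_dep => i; apply: add0r. Qed.
Fact dfunND : left_inverse dfun0 dfunN dfunD.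
Proof. by move=> f; apply: functional_extensionality_dep => i; apply: addNr. Qed.
HB.instance Definition _ := GRing.isZmodule.Build dfun dfunA dfunC dfun0D dfunND.

Lemma dfunP f g : (forall i, f i = g i) -> f = g.
Proof. exact: functional_extensionality_dep. Qed.

Definition ev i (f : dfun) : V i := f i.
Fact ev_zmod i : zmod_morphism (ev i). Proof. by []. Qed.
HB.instance Definition _ i := GRing.isZmodMorphism.Build dfun (V i) (ev i) (ev_zmod i).

Lemma dfun_sumE (J : Type) (s : seq J) (F : J -> dfun) i :
  (\sum_(j <- s) F j) i = \sum_(j <- s) F j i.
Proof. exact: (raddf_sum (ev i)). Qed.

Lemma dfun_mulrzE f (k : int) i : (f *~ k) i = f i *~ k.
Proof. exact: (raddfMz (ev i)). Qed.

End DependentFunctions.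

Section Homology.
Variables (U V W : zmodType) (d1 : {additive U -> V}) (d2 : {additive V -> W}).

Definition cycle_pred : {pred V} := fun z => d2 z == 0.
Fact cycle_closed : zmod_closed cycle_pred.
Proof.
by split=> [|x y]; rewrite !unfold_in ?raddf0 // => /eqP x0 /eqP y0;
  rewrite raddfB x0 y0 subrr.
Qed.
HB.instance Definition _ := GRing.isZmodClosed.Build V cycle_pred cycle_closed.

Record cycle := Cycle { cyc : V; _ : cyc \in cycle_pred }.
HB.instance Definition _ := [isSub for cyc].
HB.instance Definition _ := [Choice of cycle by <:].
HB.instance Definition _ := [SubChoice_isSubZmodule of cycle by <:].

Lemma cycP (z : cycle) : d2 (cyc z) = 0. Proof. by apply/eqP; case: z. Qed.

Definition bound_pred : {pred cycle} := fun z => `[< exists u, d1 u = cyc z >].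
Fact bound_closed : zmod_closed bound_pred.
Proof.
split=> [|x y]; rewrite !unfold_in.
  by apply/asboolP; exists 0; rewrite raddf0.
move=> /asboolP[u ux] /asboolP[v vy]; apply/asboolP; exists (u - v).
by rewrite raddfB ux vy.
Qed.
HB.instance Definition _ := GRing.isZmodClosed.Build cycle bound_pred bound_closed.

(* ker d2 / im d1; that im d1 lies in ker d2 is dH_dH and dV_dV in the two uses
   made of this below. *)
Definition homology : zmodType := Quotient.quot bound_pred.

Definition hclass z (z0 : d2 z = 0) : homology :=
  \pi_(Quotient.quot bound_pred) (Cycle (introT eqP z0)).
Definition hrep (x : homology) : cycle := repr x.

Lemma hrepK x : hclass (cycP (hrep x)) = x.
Proof.
rewrite -[RHS]reprK /hclass; congr \pi_ _; exact: val_inj.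
Qed.

Lemma hclass_eq z z' (z0 : d2 z = 0) (z'0 : d2 z' = 0) :
  z = z' -> hclass z0 = hclass z'0.
Proof. by move=> zz'; congr \pi_ _; apply: val_inj. Qed.

Lemma hclass_eqP z z' (z0 : d2 z = 0) (z'0 : d2 z' = 0) :
  hclass z0 = hclass z'0 <-> exists u, d1 u = z - z'.
Proof.
rewrite /hclass; split=> [/eqP|[u uz]].
  by rewrite -Quotient.idealrBE unfold_in => /asboolP[u uz]; exists u; rewrite uz.
by apply/eqP; rewrite -Quotient.idealrBE unfold_in; apply/asboolP; exists u.
Qed.

Lemma hclass_eq0 z (z0 : d2 z = 0) : hclass z0 = 0 <-> exists u, d1 u = z.
Proof.
have <- : hclass (raddf0 d2) = 0.
  by rewrite -[RHS](raddf0 \pi_(Quotient.quot bound_pred)); congr \pi_ _; apply: val_inj.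
rewrite hclass_eqP; split=> -[u]; first by rewrite subr0; exists u.
by move=> uz; exists u; rewrite subr0.
Qed.

Lemma hclassD z z' (z0 : d2 z = 0) (z'0 : d2 z' = 0) (s0 : d2 (z + z') = 0) :
  hclass s0 = hclass z0 + hclass z'0.
Proof. by rewrite /hclass -raddfD; congr \pi_ _; apply: val_inj. Qed.

Lemma hclassMz z k (z0 : d2 z = 0) (s0 : d2 (z *~ k) = 0) :
  hclass s0 = hclass z0 *~ k.
Proof.
by rewrite /hclass -raddfMz; congr \pi_ _; apply: val_inj; rewrite (raddfMz val).
Qed.

End Homology.

Section HomologyMap.
Variables (U V W U' V' W' : zmodType).
Variables (d1 : {additive U -> V}) (d2 : {additive V -> W}).
Variables (d1' : {additive U' -> V'}) (d2' : {additive V' -> W'}).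
Variables (f : V -> V').
Hypothesis fD : {morph f : x y / x + y}.
Hypothesis fZ : forall z, d2 z = 0 -> d2' (f z) = 0.
Hypothesis fB : forall u, exists u', d1' u' = f (d1 u).

Definition hmap (x : homology d1 d2) : homology d1' d2' :=
  hclass d1' (fZ (cycP (hrep x))).

Lemma hmap_class z (z0 : d2 z = 0) : hmap (hclass d1 z0) = hclass d1' (fZ z0).
Proof.
rewrite /hmap; set y := hrep _; apply/hclass_eqP.
have /hclass_eqP[u uE] : hclass d1 (cycP y) = hclass d1 z0 by rewrite hrepK.
have [u' u'E] := fB u; exists u'; rewrite u'E uE.
exact: (morphD_zmod fD).
Qed.

Lemma hmapD : {morph hmap : x y / x + y}.
Proof.
move=> x y; rewrite -(hrepK x) -(hrepK y).
have s0 : d2 (cyc (hrep x) + cyc (hrep y)) = 0 by rewrite raddfD !cycP addr0.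
rewrite -(hclassD _ _ _ s0) !hmap_class -hclassD ?raddfD ?fZ ?addr0 ?cycP //.
by move=> t0; apply: hclass_eq; rewrite fD.
Qed.

End HomologyMap.

Record gcat := GCat {
  ob :> Type;
  mor : int -> ob -> ob -> zmodType;
  idm : forall X, mor 0 X X;
  mcomp : forall p q t X Y Z,
    p + q = t -> mor p Y Z -> mor q X Y -> mor t X Z;
  mcompDl : forall p q t X Y Z (e : p + q = t) (f f' : mor p Y Z) (g : mor q X Y),
    mcomp e (f + f') g = mcomp e f g + mcomp e f' g;
  mcompDr : forall p q t X Y Z (e : p + q = t) (f : mor p Y Z) (g g' : mor q X Y),
    mcomp e f (g + g') = mcomp e f g + mcomp e f g';
  mcompA : forall p q r s t u X Y Z T
      (e1 : p + q = s) (e2 : s + r = u) (e3 : q + r = t) (e4 : p + t = u)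
      (f : mor p Z T) (g : mor q Y Z) (h : mor r X Y),
    mcomp e2 (mcomp e1 f g) h = mcomp e4 f (mcomp e3 g h);
  mcomp1f : forall p X Y (e : 0 + p = p) (f : mor p X Y), mcomp e (idm Y) f = f;
  mcompf1 : forall p X Y (e : p + 0 = p) (f : mor p X Y), mcomp e f (idm X) = f
}.
Arguments mor {C} : rename.
Arguments idm {C} : rename.
Arguments mcomp {C p q t X Y Z} : rename.

(* A graded right C-module; a right module carries no Koszul sign.  Additivity
   in the morphism is not required, so this is a module over the free graded
   linear category ZC; the finitely presented modules below are C-linear. *)
Record rmod (C : gcat) := RMod {
  car :> C -> int -> zmodType;
  ract : forall p q t X Y, p + q = t -> car X p -> mor q Y X -> car Y t;
  ractD : forall p q t X Y (e : p + q = t) (x y : car X p) (f : mor q Y X),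
    ract e (x + y) f = ract e x f + ract e y f;
  ractA : forall p q r s t u X Y Z
      (e1 : p + q = s) (e2 : s + r = u) (e3 : q + r = t) (e4 : p + t = u)
      (x : car X p) (f : mor q Y X) (g : mor r Z Y),
    ract e2 (ract e1 x f) g = ract e4 x (mcomp e3 f g);
  ract1 : forall p X (e : p + 0 = p) (x : car X p), ract e x (idm X) = x
}.
Arguments ract {C} N {p q t X Y} : rename.

Lemma ract0 (C : gcat) (N : rmod C) p q t X Y (e : p + q = t) (f : mor q Y X) :
  ract N e 0 f = 0.
Proof. by apply: (addrI (ract N e 0 f)); rewrite -ractD !addr0. Qed.

(* A ZC-bimodule B: the group in degree r at (X, Y), contravariant in X and
   covariant in Y, is bcar B Y X r. *)
Record bimod (C : gcat) := BiMod {
  bcar :> C -> rmod C;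
  lact : forall p r t X Y Z, p + r = t -> mor p Y Z -> bcar Y X r -> bcar Z X t;
  lactD : forall p r t X Y Z (e : p + r = t) (f : mor p Y Z) (x y : bcar Y X r),
    lact e f (x + y) = lact e f x + lact e f y;
  lactA : forall p q r s t u X Y Z T
      (e1 : p + q = s) (e2 : s + r = u) (e3 : q + r = t) (e4 : p + t = u)
      (f : mor p Z T) (g : mor q Y Z) (x : bcar Y X r),
    lact e2 (mcomp e1 f g) x = lact e4 f (lact e3 g x);
  lact1 : forall r X Y (e : 0 + r = r) (x : bcar Y X r), lact e (idm Y) x = x;
  lact_act : forall p q r s t u X Y Z T
      (e1 : p + q = s) (e2 : s + r = u) (e3 : q + r = t) (e4 : p + t = u)
      (f : mor p Z T) (x : bcar Z Y q) (g : mor r X Y),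
    ract (bcar T) e2 (lact e1 f x) g = lact e4 f (ract (bcar Z) e3 x g)
}.
Arguments lact {C} B {p r t X Y Z} : rename.

Section Regular.
Variable C : gcat.

Definition rep (X : C) : rmod C :=
  @RMod C (fun Y p => mor p Y X) (fun p q t _ _ e f g => mcomp e f g)
    (fun p q t _ _ => @mcompDl C p q t _ _ X)
    (fun p q r s t u _ _ _ => @mcompA C p q r s t u _ _ _ X)
    (fun p _ => @mcompf1 C p _ X).

Definition reg : bimod C :=
  @BiMod C rep (fun p r t _ _ _ e f g => mcomp e f g)
    (@mcompDr C) (@mcompA C) (@mcomp1f C) (@mcompA C).

End Regular.

Section Cochains.
Variable C : gcat.

(* A homogeneous f : X_i -> X_{i-1} with X_{i-1} = X; the last two fields
   update the running output degree from s to s + |f|. *)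
Record arrow (X : C) (s : int) := Arrow {
  asrc : C;
  adeg : int;
  amor : mor adeg asrc X;
  aout : int;
  aoutE : s + adeg = aout
}.

Lemma deg_comp (s p q t u : int) (e : s + p = t) (e' : t + q = u) : s + (p + q) = u.
Proof. by rewrite addrA e. Qed.

Definition acomp X s (a : arrow X s) (b : arrow (asrc a) (aout a)) : arrow X s :=
  Arrow (mcomp erefl (amor a) (amor b)) (deg_comp (aoutE a) (aoutE b)).

Variable N : rmod C.

(* Functions of a string (f_1, ..., f_n) of composable homogeneous morphisms
   X = X_0 <- X_1 <- ... <- X_n, with value in N(X_n) of degree
   s + |f_1| + ... + |f_n|; no additivity in the f_i is required. *)
Fixpoint cochain n (X : C) (s : int) : zmodType :=
  if n is n'.+1 then
    dfun (fun a : arrow X s => cochain n' (asrc a) (aout a))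
  else N X s.

(* mulat i phi (f_1, ..., f_{n+1}) = phi (..., f_{i+1} f_{i+2}, ...), i < n *)
Fixpoint mulat n i X s : cochain n X s -> cochain n.+1 X s :=
  match n, i return cochain n X s -> cochain n.+1 X s with
  | 0, _ => fun _ => 0
  | n'.+1, 0 => fun phi a b => phi (acomp b)
  | n'.+1, i'.+1 => fun phi a => mulat i' (phi a)
  end.

(* lastact phi (f_1, ..., f_{n+1}) = phi (f_1, ..., f_n) . f_{n+1} *)
Fixpoint lastact n X s : cochain n X s -> cochain n.+1 X s :=
  match n return cochain n X s -> cochain n.+1 X s with
  | 0 => fun x a => ract N (aoutE a) x (amor a)
  | n'.+1 => fun phi a => lastact (phi a)
  end.

(* The part of the differentials common to the non-additive cohomology complex
   and to the vertical complex, that is, all but the first summand. *)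
Definition dtail n X s (phi : cochain n X s) : cochain n.+1 X s :=
  \sum_(i < n) mulat i phi *~ (-1) ^+ i.+1 + lastact phi *~ (-1) ^+ n.+1.

Lemma mulatD n i X s : {morph @mulat n i X s : x y / x + y}.
Proof.
elim: n i X s => [|n IHn] [|i] X s x y //=; rewrite ?addr0 //.
by apply: dfunP => a; apply: IHn.
Qed.

Lemma lastactD n X s : {morph @lastact n X s : x y / x + y}.
Proof.
elim: n X s => [|n IHn] X s x y /=; apply: dfunP => a; first exact: ractD.
exact: IHn.
Qed.

Lemma dtailD n X s : {morph @dtail n X s : x y / x + y}.
Proof.
move=> x y; rewrite /dtail lastactD mulrzDl addrACA -big_split /=; congr (_ + _).
by apply: eq_bigr => i _; rewrite mulatD mulrzDl.
Qed.

End Cochains.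
Arguments mulat {C N n} i {X s} phi a : rename.
Arguments lastact {C N n X s} phi a : rename.
Arguments dtail {C N n X s} phi a : rename.

Section SquareZero.
Variables (C : gcat) (N : rmod C).

Lemma cochain_comp n X s (phi : cochain N n.+1 X s) p q d d' Y Z (f : mor p Y X)
    (g : mor q Z Y) (e : p + q = d) (e' : p + q = d') t (c : s + d = t) (c' : s + d' = t) :
  phi (Arrow (mcomp e f g) c) = phi (Arrow (mcomp e' f g) c').
Proof. by case: _ / e c => c; case: _ / e' c' => c'; rewrite (int_irr c c'). Qed.

(* (f_1, ...) |-> phi(a f_1, ...) *)
Definition shift n X s (phi : cochain N n.+1 X s) (a : arrow X s) :
  cochain N n.+1 (asrc a) (aout a) := fun b => phi (acomp b).
Arguments shift {n X s} phi a b : rename.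

Lemma shift_acomp n X s (phi : cochain N n.+1 X s) (a : arrow X s)
    (b : arrow (asrc a) (aout a)) : shift phi (acomp b) = shift (shift phi a) b.
Proof.
apply: dfunP => -[Z r h v e]; rewrite /shift /acomp /=.
have E : adeg a + (adeg b + r) = adeg a + adeg b + r by rewrite addrA.
by rewrite (mcompA erefl erefl erefl E); apply: cochain_comp.
Qed.

Lemma dtailS n X s (phi : cochain N n.+1 X s) a :
  dtail phi a = - shift phi a - dtail (phi a).
Proof.
rewrite /dtail big_ord_recl expr1 mulrN1z opprD addrA.
rewrite -[LHS]/(- shift phi a + (\sum_(i < n) mulat i.+1 phi *~ (-1) ^+ i.+2) a
  + (lastact phi *~ (-1) ^+ n.+2) a).
rewrite dfun_sumE dfun_mulrzE [(-1) ^+ n.+2]exprS mulN1r mulrNz; congr (_ + _ - _).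
rewrite -sumrN; apply: eq_bigr => i _.
by rewrite dfun_mulrzE [(-1) ^+ i.+2]exprS mulN1r mulrNz.
Qed.

Lemma dtail0E X s (x : cochain N 0 X s) a :
  dtail x a = - ract N (aoutE a) x (amor a).
Proof. by rewrite /dtail big_ord0 add0r expr1 mulrN1z. Qed.

Lemma dtailB n X s (x y : cochain N n X s) : dtail (x - y) = dtail x - dtail y.
Proof. exact: (morphD_zmod (@dtailD C N n X s)). Qed.
Lemma dtailN n X s (x : cochain N n X s) : dtail (- x) = - dtail x.
Proof. have D0 := dtailB x x; rewrite !subrr in D0.
by rewrite -[- x]sub0r dtailB D0 sub0r.
Qed.

Lemma dtailMz n X s (phi : cochain N n X s) k : dtail (phi *~ k) = dtail phi *~ k.
Proof.
pose F := @dtail C N n X s.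
pose F' : {additive _ -> _} :=
  HB.pack F (GRing.isZmodMorphism.Build _ _ F (morphD_zmod (@dtailD C N n X s))).
exact: (raddfMz F').
Qed.

Lemma dtail_dtail n X s (phi : cochain N n X s) : dtail (dtail phi) = 0.
Proof.
elim: n X s phi => [|n IHn] X s phi; apply: dfunP => a; rewrite dtailS.
  apply: dfunP => b; rewrite -[LHS]/(- shift (dtail phi) a b - dtail (dtail phi a : cochain N 0 _ _) b).
  rewrite /shift dtail0E dtail0E opprK.
  have : ract N (aoutE b) (dtail phi a) (amor b) =
         - ract N (deg_comp (aoutE a) (aoutE b)) phi (mcomp erefl (amor a) (amor b)).
    apply/eqP; rewrite -addr_eq0 -(ractA (aoutE a) (aoutE b)) -ractD dtail0E addNr.
    by rewrite ract0.
  by move=> ->; rewrite opprK subrr.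
rewrite dtailS dtailB dtailN IHn subr0 opprK addrC; apply/eqP.
rewrite subr_eq0; apply/eqP; apply: dfunP => b.
by rewrite dtailS /shift dtailS shift_acomp.
Qed.

End SquareZero.
Arguments shift {C N n X s} phi a b : rename.

Section PointwiseMap.
Variables (C : gcat) (N N' : rmod C) (p : int).
Variable h : forall Y r t, p + r = t -> N Y r -> N' Y t.

Lemma deg_lmap (s s' q t : int) (e : p + s = s') (e' : s' + q = t) : p + (s + q) = t.
Proof. by rewrite addrA e. Qed.

Fixpoint lmap n X s s' (e : p + s = s') : cochain N n X s -> cochain N' n X s' :=
  match n return cochain N n X s -> cochain N' n X s' with
  | 0 => h e
  | n'.+1 => fun phi a =>
      lmap (deg_lmap e (aoutE a)) (phi (Arrow (amor a) erefl))
  end.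

Lemma lmap_irr n X s q (phi : cochain N n.+1 X s) Y (f : mor q Y X) u u' t
    (e1 : s + q = u) (e2 : s + q = u') (e : p + u = t) (e' : p + u' = t) :
  lmap e (phi (Arrow f e1)) = lmap e' (phi (Arrow f e2)).
Proof. by case: _ / e1 e => e; case: _ / e2 e' => e'; rewrite (int_irr e e'). Qed.

Hypothesis hD : forall Y r t (e : p + r = t), {morph @h Y r t e : x y / x + y}.

Lemma lmapD n X s s' (e : p + s = s') : {morph @lmap n X s s' e : x y / x + y}.
Proof.
elim: n X s s' e => [|n IHn] X s s' e x y; first exact: hD.
by apply: dfunP => a /=; apply: IHn.
Qed.

Lemma lmapMz n X s s' (e : p + s = s') k (x : cochain N n X s) :
  lmap e (x *~ k) = lmap e x *~ k.
Proof.
pose F := @lmap n X s s' e.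
pose F' : {additive _ -> _} :=
  HB.pack F (GRing.isZmodMorphism.Build _ _ F (morphD_zmod (@lmapD n X s s' e))).
exact: (raddfMz F').
Qed.

Lemma lmap_mulat n i X s s' (e : p + s = s') (phi : cochain N n X s) :
  lmap e (mulat i phi) = mulat i (lmap e phi).
Proof.
elim: n i X s s' e phi => [|n IHn] [|i] X s s' e phi.
- by apply: (addrI (lmap e (mulat 0 phi))); rewrite -lmapD /= !addr0.
- by apply: (addrI (lmap e (mulat i.+1 phi))); rewrite -lmapD /= !addr0.
- by apply: dfunP => a; apply: dfunP => b; rewrite /= /acomp /=; exact: lmap_irr.
by apply: dfunP => a; apply: IHn.
Qed.

Hypothesis h_act : forall q r s t u X Y
  (e1 : r + q = s) (e2 : p + s = t) (e3 : p + r = u) (e4 : u + q = t)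
  (x : N X r) (f : mor q Y X),
  h e2 (ract N e1 x f) = ract N' e4 (h e3 x) f.

Lemma lmap_lastact n X s s' (e : p + s = s') (phi : cochain N n X s) :
  lmap e (lastact phi) = lastact (lmap e phi).
Proof.
elim: n X s s' e phi => [|n IHn] X s s' e phi; apply: dfunP => a /=.
  exact: h_act.
exact: IHn.
Qed.

Lemma lmap_dtail n X s s' (e : p + s = s') (phi : cochain N n X s) :
  lmap e (dtail phi) = dtail (lmap e phi).
Proof.
rewrite /dtail lmapD lmapMz lmap_lastact; congr (_ + _).
elim/big_rec2: _ => [|i y1 y2 _ IH]; last by rewrite lmapD lmapMz lmap_mulat IH.
by apply: (addrI (lmap e (0 : cochain N n.+1 X s))); rewrite -lmapD !addr0.
Qed.

End PointwiseMap.

Lemma lmap_comp (C : gcat) (N N' N'' : rmod C) p q pq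
    (h : forall Y r t, p + r = t -> N' Y r -> N'' Y t)
    (k : forall Y r t, q + r = t -> N Y r -> N' Y t)
    (l : forall Y r t, pq + r = t -> N Y r -> N'' Y t) :
  (forall Y r s t (e1 : q + r = s) (e2 : p + s = t) (e3 : pq + r = t) (x : N Y r),
    h _ _ _ e2 (k _ _ _ e1 x) = l _ _ _ e3 x) ->
  forall n X r s t (e1 : q + r = s) (e2 : p + s = t) (e3 : pq + r = t)
    (phi : cochain N n X r),
    lmap h e2 (lmap k e1 phi) = lmap l e3 phi.
Proof.
move=> hkl; elim=> [|n IHn] X r s t e1 e2 e3 phi; first exact: hkl.
by apply: dfunP => a; apply: IHn.
Qed.

Lemma lmap_id (C : gcat) (N : rmod C)
    (h : forall Y r t, 0 + r = t -> N Y r -> N Y t) :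
  (forall Y r (e : 0 + r = r) (x : N Y r), h _ _ _ e x = x) ->
  forall n X r (e : 0 + r = r) (phi : cochain N n X r), lmap h e phi = phi.
Proof.
move=> h1; elim=> [|n IHn] X r e phi; first exact: h1.
apply: dfunP => -[Y q f t e'] /=; case: _ / e' => /=; exact: IHn.
Qed.

Lemma lmap_ext (C : gcat) (N N' : rmod C) p
    (h k : forall Y r t, p + r = t -> N Y r -> N' Y t) :
  (forall Y r t (e : p + r = t) x, h Y r t e x = k Y r t e x) ->
  forall n X r t (e : p + r = t) (phi : cochain N n X r),
    lmap h e phi = lmap k e phi.
Proof.
move=> hk; elim=> [|n IHn] X r t e phi; first exact: hk.
by apply: dfunP => a; apply: IHn.
Qed.

Lemma deg_swap (r p t : int) (e : r + p = t) : p + r = t.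
Proof. by rewrite addrC. Qed.

Lemma sign_add (r p q : int) :
  (-1) ^ (r * (p + q)) = (-1) ^ (r * q) * (-1) ^ (r * p) :> int.
Proof. by rewrite mulrDr addrC exprzDr. Qed.

Section NonAdditiveCohomology.
Variables (C : gcat) (B : bimod C).

Definition hcochain n r : zmodType := dfun (fun X0 : C => cochain (B X0) n X0 r).

Definition dhead n r (phi : hcochain n r) : hcochain n.+1 r :=
  fun X0 (a : arrow X0 r) =>
    lmap (fun Y s t (e : adeg a + s = t) x => lact B e (amor a) x)
      (deg_swap (aoutE a)) (phi (asrc a)) *~ (-1) ^ (r * adeg a).
Arguments dhead {n r} phi X0 a : rename.

Definition dH n r (phi : hcochain n r) : hcochain n.+1 r :=
  fun X0 => dhead phi X0 + dtail (phi X0).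
Arguments dH n r phi X0 : clear implicits, rename.

Fact dH_zmod n r : zmod_morphism (dH n r).
Proof.
apply: morphD_zmod => x y; apply: dfunP => X0; rewrite /dH /= dtailD.
rewrite /= [RHS]addrACA; congr (_ + _); apply: dfunP => a.
by rewrite /dhead /= lmapD ?mulrzDl // => Y s t e; apply: lactD.
Qed.
HB.instance Definition _ n r := GRing.isZmodMorphism.Build _ _ (dH n r) (@dH_zmod n r).

(* The differential arriving in degree n; it is zero for n = 0. *)
Definition dHin n r : hcochain n.-1 r -> hcochain n r :=
  if n is n'.+1 return hcochain n.-1 r -> hcochain n r then dH n' r
  else fun _ => 0.
Arguments dHin n r phi X0 : clear implicits, rename.

Fact dHin_zmod n r : zmod_morphism (dHin n r).
Proof. by case: n => [|n] x y; rewrite ?subr0 //; apply: raddfB. Qed.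
HB.instance Definition _ n r :=
  GRing.isZmodMorphism.Build _ _ (dHin n r) (@dHin_zmod n r).

Lemma dH_dH n r (phi : hcochain n r) : dH n.+1 r (dH n r phi) = 0.
Proof.
apply: dfunP => X0; rewrite /dH dtailD dtail_dtail addr0; apply: dfunP => a.
rewrite -[LHS]/(dhead (dH n r phi) X0 a + dtail (dhead phi X0) a) dtailS.
rewrite {1}/dhead /dH lmapD; last by move=> *; apply: lactD.
have -> : dtail (dhead phi X0 a) =
    lmap (fun Y s t (e : adeg a + s = t) x => lact B e (amor a) x)
      (deg_swap (aoutE a)) (dtail (phi (asrc a))) *~ (-1) ^ (r * adeg a).
  rewrite /dhead dtailMz lmap_dtail // => *; first exact: lactD.
  by symmetry; apply: lact_act.
rewrite mulrzDl addrACA subrr addr0; apply/eqP; rewrite subr_eq0; apply/eqP.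
apply: dfunP => b; rewrite dfun_mulrzE /shift /dhead /= lmapMz; last first.
  by move=> *; apply: lactD.
rewrite -mulrzA sign_add; congr (_ *~ _).
by apply: lmap_comp => Y s u v e1 e2 e3 x; rewrite (lactA erefl e3 e1 e2).
Qed.

(* H^{n,r}(C, B) *)
Definition Hcoh n r : zmodType := homology (dHin n r) (dH n r).

End NonAdditiveCohomology.
Arguments dhead {C B n r} phi X0 a : rename.
Arguments dH {C B} n r phi X0 : rename.
Arguments dHin {C B} n r phi X0 : rename.

Section Vertical.
Variables (C : gcat) (M N : rmod C).

(* A homogeneous x in M(X_0), with the output degree r + |x|. *)
Record elt (r : int) := Elt {
  eob : C;
  edeg : int;
  evl : M eob edeg;
  eout : int;
  eoutE : r + edeg = eout
}.

Definition eact r (x : elt r) (a : arrow (eob x) (eout x)) : elt r :=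
  Elt (ract M erefl (evl x) (amor a)) (deg_comp (eoutE x) (aoutE a)).

(* Maps (x, f_1, ..., f_q) |-> phi(x, f_1, ..., f_q) in N(X_q), homogeneous of
   degree r; for M = N = M_0 these are the components of C^{0,q}. *)
Definition vcochain q r : zmodType :=
  dfun (fun x : elt r => cochain N q (eob x) (eout x)).

Definition vhead q r (phi : vcochain q r) : vcochain q.+1 r :=
  fun x a => phi (eact a).
Arguments vhead {q r} phi x a : rename.

Definition dV q r (phi : vcochain q r) : vcochain q.+1 r :=
  fun x => vhead phi x + dtail (phi x).
Arguments dV q r phi x : clear implicits, rename.

Lemma dV_zmod q r : zmod_morphism (dV q r).
Proof.
apply: morphD_zmod => phi psi; apply: dfunP => x; rewrite /dV /= dtailD.
by rewrite /= [RHS]addrACA.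
Qed.
HB.instance Definition _ q r := GRing.isZmodMorphism.Build _ _ (dV q r) (@dV_zmod q r).

Definition dVin q r : vcochain q.-1 r -> vcochain q r :=
  if q is q'.+1 return vcochain q.-1 r -> vcochain q r then dV q' r
  else fun _ => 0.
Arguments dVin q r phi x : clear implicits, rename.

Fact dVin_zmod q r : zmod_morphism (dVin q r).
Proof. by case: q => [|q] x y; rewrite ?subr0 //; apply: raddfB. Qed.
HB.instance Definition _ q r :=
  GRing.isZmodMorphism.Build _ _ (dVin q r) (@dVin_zmod q r).

Lemma vcochain_act q r (phi : vcochain q r) p d u u' t X Y (x : M X p)
    (f : mor d Y X) (e : p + d = u) (e' : p + d = u')
    (c : r + u = t) (c' : r + u' = t) :
  phi (Elt (ract M e x f) c) = phi (Elt (ract M e' x f) c').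
Proof. by case: _ / e c => c; case: _ / e' c' => c'; rewrite (int_irr c c'). Qed.

Lemma dV_dV q r (phi : vcochain q r) : dV q.+1 r (dV q r phi) = 0.
Proof.
apply: dfunP => x; rewrite /dV dtailD dtail_dtail addr0; apply: dfunP => a.
rewrite -[LHS]/(vhead phi (eact a) + dtail (phi (eact a)) + dtail (vhead phi x) a).
rewrite dtailS addrACA subrr addr0; apply/eqP; rewrite subr_eq0; apply/eqP.
apply: dfunP => b; rewrite /shift /vhead /eact /=.
have E : edeg x + (adeg a + adeg b) = edeg x + adeg a + adeg b by rewrite addrA.
by rewrite (ractA erefl erefl erefl E); apply: vcochain_act.
Qed.

(* Ext^{q,r}(M, N), computed by the vertical complex of the bicomplex: maps that
   are not multilinear, even in x. *)
Definition Ext q r : zmodType := homology (dVin q r) (dV q r).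

End Vertical.
Arguments vhead {C M N q r} phi x a : rename.
Arguments dV {C M N} q r phi x : rename.
Arguments dVin {C M N} q r phi x : rename.

Section GradedHom.
Variables (C : gcat) (M N : rmod C) (d : int).

Record ghom := GHom {
  gfun :> forall p t X, d + p = t -> M X p -> N X t;
  gfunD : forall p t X (e : d + p = t), {morph @gfun p t X e : x y / x + y};
  gfun_act : forall p q s t u X Y
      (e1 : p + q = s) (e2 : d + s = t) (e3 : d + p = u) (e4 : u + q = t)
      (x : M X p) (f : mor q Y X),
    gfun e2 (ract M e1 x f) = ract N e4 (gfun e3 x) f
}.

Lemma ghomP (g h : ghom) :
  (forall p t X (e : d + p = t) x, g p t X e x = h p t X e x) -> g = h.
Proof.
case: g h => [g gD gA] [h hD hA] /= gh.
have {}gh : g = h.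
  do 5! (apply: functional_extensionality_dep => ?); exact: gh.
by case: _ / gh in hD hA *; congr GHom; apply: Prop_irrelevance.
Qed.

HB.instance Definition _ := gen_eqMixin ghom.
HB.instance Definition _ := gen_choiceMixin ghom.

Fact ghom0_D p t X (e : d + p = t) :
  {morph (fun _ : M X p => 0 : N X t) : x y / x + y}.
Proof. by move=> x y; rewrite addr0. Qed.

Definition ghom0 : ghom.
Proof.
refine (@GHom (fun _ _ _ _ _ => 0) ghom0_D _).
by move=> *; rewrite ract0.
Defined.

Definition ghomN (g : ghom) : ghom.
Proof.
refine (@GHom (fun p t X e x => - g p t X e x) _ _).
- by move=> p t X e x y; rewrite gfunD opprD.
- move=> p q s t u X Y e1 e2 e3 e4 x f.
  rewrite (gfun_act g e1 e2 e3 e4); apply: (addrI (ract N e4 (g _ _ _ e3 x) f)).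
  by rewrite subrr -ractD subrr ract0.
Defined.

Definition ghomD (g h : ghom) : ghom.
Proof.
refine (@GHom (fun p t X e x => g p t X e x + h p t X e x) _ _).
- by move=> p t X e x y; rewrite !gfunD addrACA.
- move=> p q s t u X Y e1 e2 e3 e4 x f.
  by rewrite !(gfun_act _ e1 e2 e3 e4) ractD.
Defined.

Fact ghomA : associative ghomD.
Proof. by move=> f g h; apply: ghomP => p t X e x; apply: addrA. Qed.
Fact ghomC : commutative ghomD.
Proof. by move=> f g; apply: ghomP => p t X e x; apply: addrC. Qed.
Fact ghom0D : left_id ghom0 ghomD.
Proof. by move=> f; apply: ghomP => p t X e x; apply: add0r. Qed.
Fact ghomND : left_inverse ghom0 ghomN ghomD.
Proof. by move=> f; apply: ghomP => p t X e x; apply: addNr. Qed.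
HB.instance Definition _ := GRing.isZmodule.Build ghom ghomA ghomC ghom0D ghomND.

End GradedHom.

Section GradedHomCategory.
Variable C : gcat.

Lemma deg_gcomp (p q s r t : int) (e : p + q = s) (e' : s + r = t) : p + (q + r) = t.
Proof. by rewrite addrA e. Qed.

Definition gcomp (L M N : rmod C) p q s (e : p + q = s)
  (g : ghom M N p) (h : ghom L M q) : ghom L N s.
Proof.
refine (@GHom C L N s
  (fun r t X e' x => g _ _ _ (deg_gcomp e e') (h _ _ _ erefl x)) _ _).
- by move=> r t X e' x y; rewrite !gfunD.
- move=> r r' s' t u X Y e1 e2 e3 e4 x f.
  have eh : q + r + r' = q + s' by rewrite -addrA e1.
  by rewrite (gfun_act h e1 _ erefl eh) (gfun_act g eh _ (deg_gcomp e e3) e4).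
Defined.

Lemma gcompE (L M N : rmod C) p q s (e : p + q = s) (g : ghom M N p)
    (h : ghom L M q) r u t X (e' : s + r = t) (e1 : q + r = u) (e2 : p + u = t) x :
  gcomp e g h r t X e' x = g _ _ X e2 (h _ _ X e1 x).
Proof. by case: _ / e1 e2 => e2 /=; rewrite (int_irr (deg_gcomp e e') e2). Qed.

Lemma deg_gid (p t : int) (e : 0 + p = t) : p = t.
Proof. by rewrite -e add0r. Qed.

Definition gid (M : rmod C) : ghom M M 0.
Proof.
refine (@GHom C M M 0 (fun p t X e x => ecast t (M X t) (deg_gid e) x) _ _).
- by move=> p t X e; case: _ / (deg_gid e).
- move=> p q s t u X Y e1 e2 e3 e4 x f.
  move: (deg_gid e2) (deg_gid e3) e4 => E2 E3.
  by case: _ / E2; case: _ / E3 => e4; rewrite (int_irr e1 e4).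
Defined.

Lemma gidE (M : rmod C) p X (e : 0 + p = p) (x : M X p) : gid M p p X e x = x.
Proof. by rewrite /= (int_irr (deg_gid e) erefl). Qed.

End GradedHomCategory.

Section Presentations.
Variable C : gcat.

(* Homogeneous generators x_i in degree gdeg i at the object gob i, and
   relations \sum_i x_i . relc j i in degree rdeg j at the object rob j. *)
Record pres := Pres {
  ngen : nat;
  gob : 'I_ngen -> C;
  gdeg : 'I_ngen -> int;
  nrel : nat;
  rob : 'I_nrel -> C;
  rdeg : 'I_nrel -> int;
  relc : forall j i, mor (rdeg j - gdeg i) (rob j) (gob i)
}.

Variable P : pres.

(* The direct sum of the representables C(-, gob i), shifted so that the i-th
   generator has degree gdeg i. *)
Definition pfree X p : zmodType :=
  dfun (fun i : 'I_(ngen P) => mor (p - gdeg i) X (gob i)).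

Lemma deg_fact (p q t a : int) (e : p + q = t) : p - a + q = t - a.
Proof. by rewrite addrAC e. Qed.

Definition pfact p q t X Y (e : p + q = t) (x : pfree X p) (f : mor q Y X) :
  pfree Y t := fun i => mcomp (deg_fact (gdeg i) e) (x i) f.
Arguments pfact {p q t X Y} e x f i : rename.

Lemma deg_rel (p a b : int) : b - a + (p - b) = p - a.
Proof. by rewrite addrC addrA subrK. Qed.

Definition prel X p : {pred pfree X p} := fun x =>
  `[< exists h : forall j : 'I_(nrel P), mor (p - rdeg j) X (rob j),
        forall i, x i = \sum_j mcomp (deg_rel p (gdeg i) (rdeg j)) (relc j i) (h j) >].
Arguments prel X p : clear implicits.

Fact prel_closed X p : zmod_closed (prel X p).
Proof.
have cN q r t A B D (e : q + r = t) (f : @mor C q B D) (g g' : mor r A B) :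
    mcomp e f (g - g') = mcomp e f g - mcomp e f g'.
  exact: (morphD_zmod (fun g g' => mcompDr e f g g')).
split=> [|x y]; rewrite !unfold_in.
  apply/asboolP; exists (fun=> 0) => i; rewrite big1 // => j _.
  by have := cN _ _ _ X _ _ (deg_rel p (gdeg i) (rdeg j)) (relc j i) 0 0; rewrite !subrr.
move=> /asboolP[h hx] /asboolP[k ky]; apply/asboolP.
exists (fun j => h j - k j) => i; rewrite -[LHS]/(x i - y i) hx ky -sumrB.
by apply: eq_bigr => j _; rewrite cN.
Qed.
HB.instance Definition _ X p :=
  GRing.isZmodClosed.Build (pfree X p) (prel X p) (@prel_closed X p).

Lemma prel_fact p q t X Y (e : p + q = t) (x : pfree X p) (f : mor q Y X) :
  x \in prel X p -> pfact e x f \in prel Y t.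
Proof.
rewrite !unfold_in => /asboolP[h hx]; apply/asboolP.
exists (fun j => mcomp (deg_fact (rdeg j) e) (h j) f) => i.
have sD (J : Type) (s : seq J) (F : J -> mor (p - gdeg i) X (gob i))
      (e' : p - gdeg i + q = t - gdeg i) :
    mcomp e' (\sum_(j <- s) F j) f = \sum_(j <- s) mcomp e' (F j) f.
  apply: (big_morph (fun z => mcomp e' z f)); first by move=> z z'; apply: mcompDl.
  by apply: (addrI (mcomp e' (0 : mor (p - gdeg i) X (gob i)) f)); rewrite -mcompDl !addr0.
rewrite /pfact hx sD; apply: eq_bigr => j _; exact: mcompA.
Qed.

Definition pcar X p : zmodType := Quotient.quot (prel X p).
Definition pact p q t X Y (e : p + q = t) (x : pcar X p) (f : mor q Y X) :
  pcar Y t := \pi_(pcar Y t) (pfact e (repr x) f).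

Lemma pactE p q t X Y (e : p + q = t) (x : pfree X p) (f : mor q Y X) :
  pact e (\pi_(pcar X p) x) f = \pi_(pcar Y t) (pfact e x f).
Proof.
apply/eqP; rewrite -Quotient.idealrBE.
have -> : pfact e (repr (\pi_(pcar X p) x)) f - pfact e x f =
          pfact e (repr (\pi_(pcar X p) x) - x) f.
  by apply: dfunP => i; rewrite /pfact (morphD_zmod (fun z z' => mcompDl _ z z' f)).
by apply: prel_fact; rewrite Quotient.idealrBE reprK.
Qed.

Definition pmod : rmod C.
Proof.
refine (@RMod C pcar pact _ _ _).
- move=> p q t X Y e x y f; rewrite -[x]reprK -[y]reprK -raddfD !pactE -raddfD.
  by congr \pi_ _; apply: dfunP => i; apply: mcompDl.
- move=> p q r s t u X Y Z e1 e2 e3 e4 x f g; rewrite -[x]reprK (pactE e1) !pactE.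
  by congr \pi_ _; apply: dfunP => i; rewrite /pfact; apply: mcompA.
- move=> p X e x; rewrite -[x in LHS]reprK pactE -[RHS]reprK.
  congr \pi_ _; apply: dfunP => i; rewrite /pfact.
  have E : p - gdeg i + 0 = p - gdeg i by rewrite addr0.
  by rewrite (int_irr (deg_fact _ _) E) mcompf1.
Defined.

Lemma pmod_actDr p q t X Y (e : p + q = t) (x : pmod X p) (f g : mor q Y X) :
  ract pmod e x (f + g) = ract pmod e x f + ract pmod e x g.
Proof.
rewrite /= -[x]reprK !pactE -raddfD.
by congr \pi_ _; apply: dfunP => i; apply: mcompDr.
Qed.

End Presentations.

(* mod(C): finitely presented graded right C-modules and homomorphisms of all
   degrees.  Its objects are finite presentations, which gives a small category
   equivalent to that of all finitely presented modules. *)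
Definition gmod (C : gcat) : gcat.
Proof.
refine (@GCat (pres C) (fun p P Q => ghom (pmod P) (pmod Q) p)
  (fun P => gid (pmod P)) (fun p q t P Q R e g h => gcomp e g h) _ _ _ _ _).
- by move=> p q t P Q R e f f' g; apply: ghomP => r u X e' x.
- by move=> p q t P Q R e f g g'; apply: ghomP => r u X e' x; apply: gfunD.
- move=> p q r s t u P Q R S e1 e2 e3 e4 f g h; apply: ghomP => m v X e x.
  have e5 : s + (r + m) = v by rewrite addrA e2.
  have e6 : q + (r + m) = t + m by rewrite addrA e3.
  have e7 : p + (t + m) = v by rewrite addrA e4.
  rewrite (gcompE _ _ _ _ erefl e5) (gcompE _ _ _ _ e6 e7).
  by rewrite (gcompE _ _ _ _ erefl e7) (gcompE _ _ _ _ erefl e6).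
- move=> p P Q e f; apply: ghomP => m v X e' x.
  have e'' : 0 + v = v by rewrite add0r.
  by rewrite (gcompE _ _ _ _ e' e'') gidE.
- move=> p P Q e f; apply: ghomP => m v X e' x.
  have e'' : 0 + m = m by rewrite add0r.
  by rewrite (gcompE _ _ _ _ e'' e') gidE.
Defined.

Section ExtFunctoriality.
Variables (C : gcat) (n : nat).
Implicit Types L M N : rmod C.

Definition ghmap M N d (g : ghom M N d) Y s u (e : d + s = u) (y : M Y s) : N Y u :=
  g s u Y e y.

Lemma deg_vpost (d r t p u : int) (e : d + r = t) (e' : t + p = u) : d + (r + p) = u.
Proof. by rewrite addrA e. Qed.

(* (g . phi)(x, f_1, ..., f_m) = g(phi(x, f_1, ..., f_m)) *)
Definition vpost L M N d r t (e : d + r = t) (g : ghom M N d) m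
    (phi : vcochain L M m r) : vcochain L N m t :=
  fun x => lmap (ghmap g) (deg_vpost e (eoutE x)) (phi (Elt (evl x) erefl)).
Arguments vpost {L M N d r t} e g m phi x : rename.

Lemma deg_vpre (r d t p u : int) (e : r + d = t) (e' : t + p = u) : r + (d + p) = u.
Proof. by rewrite addrA e. Qed.

(* (phi . g)(x, f_1, ..., f_m) = phi(g(x), f_1, ..., f_m) *)
Definition vpre L M N r d t (e : r + d = t) (g : ghom L M d) m
    (phi : vcochain M N m r) : vcochain L N m t :=
  fun x => phi (Elt (g _ _ _ erefl (evl x)) (deg_vpre e (eoutE x))).
Arguments vpre {L M N r d t} e g m phi x : rename.

Lemma lmap_elt L M N d (g : ghom M N d) m r (phi : vcochain L M m r) X p
    (x : L X p) u u' t (e1 : r + p = u) (e2 : r + p = u')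
    (e : d + u = t) (e' : d + u' = t) :
  lmap (ghmap g) e (phi (Elt x e1)) = lmap (ghmap g) e' (phi (Elt x e2)).
Proof. by case: _ / e1 e => e; case: _ / e2 e' => e'; rewrite (int_irr e e'). Qed.

Lemma vcochain_gfun L M N d (g : ghom L M d) p X (x : L X p) u u' (e : d + p = u)
    (e' : d + p = u') m r t (c : r + u = t) (c' : r + u' = t)
    (phi : vcochain M N m r) :
  phi (Elt (g _ _ _ e x) c) = phi (Elt (g _ _ _ e' x) c').
Proof. by case: _ / e c => c; case: _ / e' c' => c'; rewrite (int_irr c c'). Qed.

Lemma vpostD L M N d r t (e : d + r = t) (g : ghom M N d) m :
  {morph @vpost L M N d r t e g m : x y / x + y}.
Proof.
by move=> x y; apply: dfunP => z; apply: lmapD => Y s u e'; apply: gfunD.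
Qed.

Lemma vpreD L M N r d t (e : r + d = t) (g : ghom L M d) m :
  {morph @vpre L M N r d t e g m : x y / x + y}.
Proof. by []. Qed.

Lemma dV_vpost L M N d r t (e : d + r = t) (g : ghom M N d) m
    (phi : vcochain L M m r) :
  dV _ _ (vpost e g m phi) = vpost e g m.+1 (dV _ _ phi).
Proof.
have gD Y s u (e' : d + s = u) : {morph @ghmap _ _ _ g Y s u e' : x y / x + y}.
  exact: gfunD.
apply: dfunP => x; rewrite /dV /vpost lmapD //; congr (_ + _); last first.
  rewrite lmap_dtail // => p q s t' u X Y e1 e2 e3 e4 y f.
  exact: gfun_act.
by apply: dfunP => a; apply: lmap_elt.
Qed.

Lemma dV_vpre L M N r d t (e : r + d = t) (g : ghom L M d) m
    (phi : vcochain M N m r) :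
  dV _ _ (vpre e g m phi) = vpre e g m.+1 (dV _ _ phi).
Proof.
apply: dfunP => x; rewrite /dV /vpre; congr (_ + _).
apply: dfunP => a; rewrite /vhead /eact /=.
have e' : d + (edeg x + adeg a) = d + edeg x + adeg a by rewrite addrA.
have c : r + (d + edeg x + adeg a) = aout a.
  by rewrite addrA (deg_vpre e (eoutE x)) (aoutE a).
rewrite (vcochain_gfun g _ erefl e' _ c) (gfun_act g _ _ erefl erefl).
by rewrite (int_irr c (deg_comp (deg_vpre e (eoutE x)) (aoutE a))).
Qed.

Fact vpost_cycle L M N d r t (e : d + r = t) (g : ghom M N d) phi :
  @dV C L M n r phi = 0 -> @dV C L N n t (vpost e g n phi) = 0.
Proof.
by move=> phi0; rewrite dV_vpost phi0; apply: (addrI (vpost e g n.+1 0));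
  rewrite -vpostD !addr0.
Qed.

Fact vpost_bound L M N d r t (e : d + r = t) (g : ghom M N d) psi :
  exists psi', @dVin C L N n t psi' = vpost e g n (@dVin C L M n r psi).
Proof.
exists (vpost e g n.-1 psi); case: n psi => [|m] psi /=; last exact: dV_vpost.
by apply: (addrI (vpost e g 0 0)); rewrite -vpostD !addr0.
Qed.

Fact vpre_cycle L M N r d t (e : r + d = t) (g : ghom L M d) phi :
  @dV C M N n r phi = 0 -> @dV C L N n t (vpre e g n phi) = 0.
Proof. by move=> phi0; rewrite dV_vpre phi0. Qed.

Fact vpre_bound L M N r d t (e : r + d = t) (g : ghom L M d) psi :
  exists psi', @dVin C L N n t psi' = vpre e g n (@dVin C M N n r psi).
Proof.
by exists (vpre e g n.-1 psi); case: n psi => [|m] psi //=; apply: dV_vpre.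
Qed.

Definition ext_post L M N d r t (e : d + r = t) (g : ghom M N d) :
    Ext L M n r -> Ext L N n t :=
  hmap (@dVin C L N n t) (@vpost_cycle L M N d r t e g).

Definition ext_pre L M N r d t (e : r + d = t) (x : Ext M N n r) (g : ghom L M d) :
    Ext L N n t :=
  hmap (@dVin C L N n t) (@vpre_cycle L M N r d t e g) x.

Lemma ext_post_class L M N d r t (e : d + r = t) (g : ghom M N d) phi
    (phi0 : @dV C L M n r phi = 0) :
  ext_post e g (hclass (@dVin C L M n r) phi0) =
  hclass (@dVin C L N n t) (vpost_cycle e g phi0).
Proof. apply: (hmap_class (@vpostD L M N d r t e g n)); exact: vpost_bound. Qed.

Lemma ext_pre_class L M N r d t (e : r + d = t) (g : ghom L M d) phi
    (phi0 : @dV C M N n r phi = 0) :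
  ext_pre e (hclass (@dVin C M N n r) phi0) g =
  hclass (@dVin C L N n t) (vpre_cycle e g phi0).
Proof. apply: (hmap_class (@vpreD L M N r d t e g n)); exact: vpre_bound. Qed.

Lemma ext_postD L M N d r t (e : d + r = t) (g : ghom M N d) :
  {morph @ext_post L M N d r t e g : x y / x + y}.
Proof. apply: (hmapD (@vpostD L M N d r t e g n)); exact: vpost_bound. Qed.

Lemma ext_preD L M N r d t (e : r + d = t) (x y : Ext M N n r) (g : ghom L M d) :
  ext_pre e (x + y) g = ext_pre e x g + ext_pre e y g.
Proof. apply: (hmapD (@vpreD L M N r d t e g n)); exact: vpre_bound. Qed.

Lemma ext_preA K L M N p q r s t u (e1 : p + q = s) (e2 : s + r = u)
    (e3 : q + r = t) (e4 : p + t = u)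
    (x : Ext M N n p) (f : ghom L M q) (g : ghom K L r) :
  ext_pre e2 (ext_pre e1 x f) g = ext_pre e4 x (gcomp e3 f g).
Proof.
rewrite -(hrepK x) (ext_pre_class e1) !ext_pre_class; apply: hclass_eq.
apply: dfunP => y; rewrite /vpre /=.
by case: _ / e3 e4 => e4; apply: (vcochain_gfun f (g _ _ _ erefl (evl y))).
Qed.

Lemma ext_pre1 M N p (e : p + 0 = p) (x : Ext M N n p) : ext_pre e x (gid M) = x.
Proof.
rewrite -[RHS]hrepK -{1}(hrepK x) ext_pre_class; apply: hclass_eq.
apply: dfunP => -[X q y u c]; rewrite /vpre.
by rewrite (vcochain_gfun (gid M) _ _ (add0r q) _ c) gidE.
Qed.

Lemma ext_postA K L M N p q r s t u (e1 : p + q = s) (e2 : s + r = u)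
    (e3 : q + r = t) (e4 : p + t = u)
    (f : ghom M N p) (g : ghom L M q) (x : Ext K L n r) :
  ext_post e2 (gcomp e1 f g) x = ext_post e4 f (ext_post e3 g x).
Proof.
rewrite -(hrepK x) (ext_post_class e3) !ext_post_class; apply: hclass_eq.
apply: dfunP => y; rewrite /vpost /=; symmetry; apply: lmap_comp.
by move=> Y a b c e5 e6 e7 z; rewrite /ghmap (gcompE _ _ _ _ e5 e6).
Qed.

Lemma ext_post1 M N r (e : 0 + r = r) (x : Ext M N n r) : ext_post e (gid N) x = x.
Proof.
rewrite -[RHS]hrepK -{1}(hrepK x) ext_post_class; apply: hclass_eq.
apply: dfunP => -[X q y u c]; rewrite /vpost /=; case: _ / c (deg_vpost _ _) => c.
by apply: lmap_id => Y s e' z; apply: gidE.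
Qed.

Lemma ext_post_pre K L M N p q r s t u (e1 : p + q = s) (e2 : s + r = u)
    (e3 : q + r = t) (e4 : p + t = u)
    (f : ghom M N p) (x : Ext L M n q) (g : ghom K L r) :
  ext_pre e2 (ext_post e1 f x) g = ext_post e4 f (ext_pre e3 x g).
Proof.
rewrite -(hrepK x) (ext_post_class e1) (ext_pre_class e3) ext_pre_class ext_post_class.
apply: hclass_eq.
by apply: dfunP => y; apply: lmap_elt.
Qed.

Definition ext_rmod (Q : gmod C) : rmod (gmod C) :=
  @RMod (gmod C) (fun P r => Ext (pmod P) (pmod Q) n r)
    (fun p q t P P' e x g => ext_pre e x g)
    (fun p q t P P' => @ext_preD (pmod P') (pmod P) (pmod Q) p q t)
    (fun p q r s t u P P' P'' =>
       @ext_preA (pmod P'') (pmod P') (pmod P) (pmod Q) p q r s t u)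
    (fun p P => @ext_pre1 (pmod P) (pmod Q) p).

Definition ext_bimod : bimod (gmod C) :=
  @BiMod (gmod C) ext_rmod (fun p r t P Q R e g x => ext_post e g x)
    (fun p r t P Q R e => @ext_postD (pmod P) (pmod Q) (pmod R) p r t e)
    (fun p q r s t u P Q R S =>
       @ext_postA (pmod P) (pmod Q) (pmod R) (pmod S) p q r s t u)
    (fun r P Q => @ext_post1 (pmod P) (pmod Q) r)
    (fun p q r s t u P Q R S =>
       @ext_post_pre (pmod P) (pmod Q) (pmod R) (pmod S) p q r s t u).

End ExtFunctoriality.

Section Edge.
Variables (C : gcat) (r : int).

Definition evact (M : rmod C) p X (x : M X p) Y s u (e : p + s = u)
    (f : reg C X Y s) : M Y u := ract M e x f.

(* xi(phi)(M)(x, f_1, ..., f_n) = (-1)^{|phi||x|} x . phi(f_1, ..., f_n) *)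
Definition xi n (phi : hcochain (reg C) n r) (M : rmod C) : vcochain M M n r :=
  fun x => lmap (evact (evl x)) (deg_swap (eoutE x)) (phi (eob x))
             *~ (-1) ^ (r * edeg x).

End Edge.
Arguments xi {C r n} phi M x : rename.

Section EdgeTheory.
Variables (C : gcat) (r : int).

Definition linear_rmod (M : rmod C) := forall p q t X Y (e : p + q = t)
  (x : M X p) (f g : mor q Y X), ract M e x (f + g) = ract M e x f + ract M e x g.

Variables (M : rmod C) (M_lin : linear_rmod M).

Lemma xiD n : {morph (fun phi : hcochain (reg C) n r => xi phi M) : x y / x + y}.
Proof.
move=> phi psi; apply: dfunP => x; rewrite /xi lmapD ?mulrzDl //.
by move=> *; apply: M_lin.
Qed.

Lemma dV_xi n (phi : hcochain (reg C) n r) :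
  dV _ _ (xi phi M) = xi (dH _ _ phi) M.
Proof.
apply: dfunP => x.
have xD Y s u (e : edeg x + s = u) : {morph @evact C M _ _ (evl x) Y s u e : f g / f + g}.
  by move=> *; apply: M_lin.
rewrite /dV /xi /dH lmapD // mulrzDl lmap_dtail ?dtailMz //; last first.
  by move=> *; rewrite /evact; symmetry; apply: ractA.
congr (_ + _); apply: dfunP => a; rewrite dfun_mulrzE /vhead /dhead /= lmapMz //.
rewrite -mulrzA sign_add; congr (_ *~ _); symmetry.
by apply: lmap_comp => Y s u v e1 e2 e3 f; rewrite /evact -(ractA erefl e3 e1 e2).
Qed.

End EdgeTheory.

Section EdgeMorphism.
Variables (C : gcat) (n : nat) (r : int).

Fact pmod_linear (P : pres C) : linear_rmod (pmod P).
Proof. by move=> *; apply: pmod_actDr. Qed.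

Lemma xi_cycle (m : hcochain (reg C) n r) (m0 : dH n r m = 0) (P : gmod C) :
  dV n r (xi m (pmod P)) = 0.
Proof.
rewrite dV_xi ?m0; last exact: pmod_linear.
by apply: (addrI (xi 0 (pmod P))); rewrite -xiD ?addr0 //; apply: pmod_linear.
Qed.

(* The family of the classes of xi(m)(M) in Ext^{n,r}(M, M), for m a cocycle. *)
Definition edge_family (m : hcochain (reg C) n r) (m0 : dH n r m = 0) :
    hcochain (ext_bimod C n) 0 r :=
  fun P => hclass (dVin n r) (xi_cycle m0 P).

Lemma xi_natural (M N : rmod C) (M_lin : linear_rmod M) (N_lin : linear_rmod N)
    d t (e : r + d = t) (e' : d + r = t) (g : ghom M N d) (m : hcochain (reg C) n r) :
  vpost e' g (xi m M) *~ (-1) ^ (r * d) = vpre e g (xi m N).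
Proof.
apply: dfunP => x; rewrite dfun_mulrzE /vpost /vpre /xi.
rewrite lmapMz; last by move=> Y s u e1; apply: gfunD.
rewrite -mulrzA /= sign_add; congr (_ *~ _).
apply: lmap_comp => Y a b c e1 e2 e3 f.
by rewrite /ghmap /evact (gfun_act g e1 e2 erefl e3).
Qed.

Lemma edge_family_cycle m m0 : dH 0 r (@edge_family m m0) = 0.
Proof.
apply: dfunP => P; apply: dfunP => -[Q d g t e].
rewrite /dH /dtail big_ord0 add0r.
rewrite -[LHS]/(dhead (edge_family m0) P (Arrow g e) +
  (lastact (edge_family m0 P) *~ (-1) ^+ 1) (Arrow g e)) dfun_mulrzE expr1 mulrN1z.
apply/eqP; rewrite subr_eq0; apply/eqP; rewrite /dhead /=.
rewrite ext_post_class ext_pre_class.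
have Mz0 : dV n t (vpost (deg_swap e) g (xi m (pmod Q)) *~ (-1) ^ (r * d)) = 0.
  by rewrite raddfMz /= (vpost_cycle _ _ (xi_cycle m0 Q)) mul0rz.
rewrite -(hclassMz _ _ Mz0); apply: hclass_eq.
by apply: xi_natural; apply: pmod_linear.
Qed.

(* The edge morphism, into E_2^{0,n} = H^{0,r}(mod(C), Ext^{n,*}). *)
Definition edge (a : Hcoh (reg C) n r) : Hcoh (ext_bimod C n) 0 r :=
  hclass (dHin 0 r) (edge_family_cycle (cycP (hrep a))).

(* edge does not depend on the representatives chosen by hrep. *)
Lemma edge_class m (m0 : dH n r m = 0) :
  edge (hclass (dHin n r) m0) = hclass (dHin 0 r) (edge_family_cycle m0).
Proof.
apply: hclass_eq; apply: dfunP => P.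
set y := hrep _; apply/hclass_eqP.
have /hclass_eqP : hclass (dHin n r) (cycP y) = hclass (dHin n r) m0 by rewrite hrepK.
case=> w ww; exists (xi w (pmod P)).
have PB (k : nat) := morphD_zmod (@xiD C r _ (@pmod_linear P) k).
rewrite -PB -ww; case: (n) w {ww} => [|k] w /=; last by rewrite dV_xi //; apply: pmod_linear.
by have := PB 0 0 0; rewrite !subrr.
Qed.

Lemma edgeD : {morph edge : a b / a + b}.
Proof.
move=> a b; rewrite -(hrepK a) -(hrepK b).
have s0 : dH n r (cyc (hrep a) + cyc (hrep b)) = 0 by rewrite raddfD /= !cycP addr0.
rewrite -(hclassD _ _ _ s0) !edge_class.
have t0 : dH 0 r (edge_family (cycP (hrep a)) + edge_family (cycP (hrep b))) = 0.
  by rewrite raddfD /= !edge_family_cycle addr0.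
rewrite -(hclassD _ _ _ t0); apply: hclass_eq; apply: dfunP => P.
set z0 := xi_cycle s0 P.
have u0 : dV n r (xi (cyc (hrep a)) (pmod P) + xi (cyc (hrep b)) (pmod P)) = 0.
  by rewrite raddfD /= !xi_cycle ?cycP ?addr0.
rewrite -[RHS]/(edge_family _ P + edge_family _ P) -(hclassD _ _ _ u0).
by apply: hclass_eq; apply: xiD; apply: pmod_linear.
Qed.

End EdgeMorphism.

(* T is the category of finitely generated free Z/4-modules, in its skeletal
   form: the object m is (Z/4)^m, seen as column vectors, and a morphism m -> n
   is an n x m matrix.  Since Sigma is the identity, Sigma^p n = n and
   T_Sigma^p(m, n) = T(m, Sigma^p n) = T(m, n) for every p, and the composite
   fg = (Sigma^q f) g is the matrix product. *)
Definition T_Sigma : gcat.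
Proof.
refine (@GCat nat (fun _ m n => 'M['Z_4]_(n, m)) (fun m => 1%:M)
  (fun p q t m n k _ f g => f *m g) _ _ _ _ _).
- by move=> p q t m n k _ f f' g; apply: mulmxDl.
- by move=> p q t m n k _ f g g'; apply: mulmxDr.
- by move=> p q r s t u m n k l _ _ _ _ f g h; rewrite mulmxA.
- by move=> p m n _ f; apply: mul1mx.
- by move=> p m n _ f; apply: mulmx1.
Defined.

(* Main.v *)
Require Import Defs.
From HB Require Import structures.
From mathcomp Require Import all_boot all_order all_algebra.
From mathcomp Require Import ring.
From mathcomp Require Import boolp ring_quotient.

(** Why the edge morphism vanishes.

    Let m be a 3-cocycle of degree -1.  Since Sigma is the identity, a finitely
    presented module over T_Sigma is, in every degree, the same finitely
    generated Z/4-module, hence a finite direct sum of copies of Z/4 and Z/2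
    (Z4_diagonal, pmod_null).  The classes of xi m are natural in the module, so
    it is enough to show that they vanish on these two summands (null_retract).
    On the free module Z/4 the cocycle condition itself exhibits xi m as a
    coboundary (null_rep).

    On the module Z/2 the class lies in Ext^3(Z/2, Z/2) = Z/2, where it is the
    Toda bracket of the maps 2, 2, 2 : Z/4 -> Z/4 formed with m, taken modulo 2.
    This bracket vanishes for the following reason.  For a morphism x of free
    modules, add the brackets of the strings (x, 2, 2), (2, x, 2) and (2, 2, x),
    modulo 2.  As 2 commutes with everything and 2 . 2 = 0, the result is a
    derivation in x (bracketM).  On an additive category a derivation vanishes
    on identities and therefore on integers (derivation_two), and its value at
    x = 2 is three times the bracket of 2, 2, 2, which modulo 2 is that bracket
    (bracket_two).

    It remains to turn this vanishing into a primitive of xi m on Z/2.  Consider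
    the extension Z/2 -> Z/4 -> Z/2, whose first map inc is multiplication by 2.
    Then inc . xi m is the coboundary of m(inc x, f, g), so the class of xi m is
    the image under the connecting morphism of the class of m(inc x, f, g) modulo
    2 in Ext^2(Z/2, Z/2).  A primitive of the latter is built by descending
    m(2, y, f), which is a primitive for y in Z/4, along Z/4 -> Z/2
    (primitive_cobounds); the only obstruction met on the way is the bracket of
    2, 2, 2 (jump_two, jump_defect_eq0).  Dividing by inc then gives a primitive
    of xi m (halves_cobounds, Z2mod_null). *)
Set Implicit Arguments.
Unset Strict Implicit.
Unset Printing Implicit Defensive.
Import GRing.Theory.
Local Open Scope ring_scope.
Local Open Scope quotient_scope.

(** * Cancellation in groups of exponent two *)

(** The shape of a sum whose summands are numbered.  Several cocycle relations
    are going to be added at a time, which gives sums of about fifty terms; modulo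
    2 such a sum vanishes because each term occurs an even number of times, and
    on numbers this is decided by computation. *)
Inductive sum_tree := Leaf of nat | Add of sum_tree & sum_tree.
Fixpoint leaves t := match t with Leaf i => [:: i] | Add t u => leaves t ++ leaves u end.

Section ExponentTwo.
Variables (U : zmodType) (U2 : forall x : U, x + x = 0).

Fixpoint sum_of (env : nat -> U) t :=
  match t with Leaf i => env i | Add t u => sum_of env t + sum_of env u end.

Lemma exp2_cancel (env : nat -> U) t :
  all (fun i => ~~ odd (count_mem i (leaves t))) (undup (leaves t)) -> sum_of env t = 0.
Proof.
have -> : sum_of env t = \sum_(i <- leaves t) env i.
  by elim: t => [i|t IHt u IHu] /=; rewrite ?big_seq1 // big_cat IHt IHu.
move=> /allP t_even; rewrite -[LHS]big_undup_iterop_count big_seq big1 // => i.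
move=> /t_even /even_halfK ti; rewrite -[LHS]/(env i *+ _) -ti.
by rewrite -addnn mulrnDr U2.
Qed.

Lemma exp2_eq (x y : U) : x + y = 0 -> x = y.
Proof. by move=> xy0; apply: (addIr y); rewrite xy0 U2. Qed.

(** Used backwards, to add a known relation r = 0 to the sum at hand. *)
Lemma exp2_comb (x r : U) : r = 0 -> x + r = 0 -> x = 0.
Proof. by move=> ->; rewrite addr0. Qed.
Lemma exp2_sum (x y : U) : x = y -> x + y = 0.
Proof. by move=> ->; apply: U2. Qed.
End ExponentTwo.

Lemma addmx_Z2 m n (A : 'M['Z_2]_(m, n)) : A + A = 0.
Proof. by apply/matrixP => i j; rewrite !mxE; case: (A i j) => -[|[|]] // k; apply/val_inj. Qed.

Lemma oppmx_Z2 m n (x : 'M['Z_2]_(m, n)) : - x = x.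
Proof. by apply/eqP; rewrite eq_sym -addr_eq0 addmx_Z2. Qed.

(** exp2 closes a goal e = 0 by numbering the summands of e up to syntactic
    equality and counting how often each of them occurs. *)
Ltac mem_atom a l :=
  lazymatch l with
  | nil => false
  | cons a _ => true
  | cons _ ?l' => mem_atom a l'
  end.
Ltac atoms_of e l :=
  lazymatch e with
  | ?x + ?y => let l' := atoms_of x l in atoms_of y l'
  | ?a => lazymatch mem_atom a l with true => l | false => constr:(cons a l) end
  end.
Ltac atom_index a l :=
  lazymatch l with
  | cons a _ => constr:(0%N)
  | cons _ ?l' => let i := atom_index a l' in constr:(S i)
  end.
Ltac tree_of e l :=
  lazymatch e with
  | ?x + ?y => let t := tree_of x l in let u := tree_of y l in constr:(Add t u)
  | ?a => let i := atom_index a l in constr:(Leaf i)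
  end.
Ltac exp2 U2 :=
  lazymatch goal with
  | |- ?e = 0 :> ?T =>
    let l := atoms_of e (@nil T) in
    let t := tree_of e l in
    exact (@exp2_cancel _ U2 (fun i => nth 0 l i) t isT)
  end.

(** * Matrices over Z/4 modulo two *)
Definition red4 (a : 'Z_4) : 'Z_2 := (a : nat)%:R.
Fact red4_zmod : zmod_morphism red4.
Proof. by do 2! [case=> -[|[|[|[|?]]]] ?] => //; apply: val_inj. Qed.
Fact red4_monoid : monoid_morphism red4.
Proof. by split; [apply: val_inj | do 2! [case=> -[|[|[|[|?]]]] ?] => //; apply: val_inj]. Qed.
HB.instance Definition _ := GRing.isZmodMorphism.Build _ _ red4 red4_zmod.
HB.instance Definition _ := GRing.isMonoidMorphism.Build _ _ red4 red4_monoid.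

Notation red := (map_mx red4).
(** A section of the reduction which is neither additive nor compatible with
    products; carry below measures the second failure. *)
Definition lift_mx m n (x : 'M['Z_2]_(m, n)) : 'M['Z_4]_(m, n) :=
  map_mx (fun a : 'Z_2 => (a : nat)%:R) x.
(** Meaningful on even matrices only, where it picks one of the halves; two halves
    differ by an even matrix. *)
Definition halve m n (z : 'M['Z_4]_(m, n)) : 'M['Z_4]_(m, n) :=
  map_mx (fun a : 'Z_4 => (a : nat)./2%:R) z.
(** The monomorphism Z/2 -> Z/4 with image the even elements, entrywise. *)
Definition inc m n (x : 'M['Z_2]_(m, n)) : 'M['Z_4]_(m, n) := lift_mx x *+ 2.

Section Reduction.
Variables m n : nat.
Implicit Types (z : 'M['Z_4]_(m, n)) (x y : 'M['Z_2]_(m, n)).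

Lemma red_lift x : red (lift_mx x) = x.
Proof. by apply/matrixP=> i j; rewrite !mxE; case: (x i j) => -[|[|]] // k; apply: val_inj. Qed.

Lemma double_halve z : red z = 0 -> halve z *+ 2 = z.
Proof.
move=> /matrixP z0; apply/matrixP=> i j; have := z0 i j; rewrite mulr2n !mxE.
by case: (z i j) => -[|[|[|[|?]]]] // k _; apply: val_inj.
Qed.

Lemma double_eq0 z : z *+ 2 = 0 <-> red z = 0.
Proof.
split=> /matrixP z0; apply/matrixP=> i j; have := z0 i j; rewrite ?mulr2n !mxE;
by case: (z i j) => -[|[|[|[|?]]]] // k _; apply: val_inj.
Qed.

Lemma red_double z : red (z *+ 2) = 0.
Proof. by rewrite raddfMn mulr2n addmx_Z2. Qed.

Lemma inc_red z : inc (red z) = z *+ 2.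
Proof.
apply/eqP; rewrite -subr_eq0 -mulrnBl; apply/eqP/double_eq0.
by rewrite raddfB /= red_lift subrr.
Qed.

Lemma inc_inj : injective (@inc m n).
Proof.
move=> x y /eqP; rewrite -subr_eq0 -mulrnBl => /eqP/double_eq0.
by rewrite raddfB /= !red_lift => /eqP; rewrite subr_eq0 => /eqP.
Qed.

Lemma incD : {morph @inc m n : x y / x + y}.
Proof.
by move=> x y; rewrite -[x in LHS]red_lift -[y in LHS]red_lift -raddfD inc_red mulrnDl.
Qed.

Lemma inc_halve z : red z = 0 -> inc (red (halve z)) = z.
Proof. by rewrite inc_red; apply: double_halve. Qed.

Lemma inc_double x : inc x *+ 2 = 0.
Proof. by apply/double_eq0; rewrite red_double. Qed.

Lemma incN x : - inc x = inc x.
Proof. by apply/eqP; rewrite eq_sym -addr_eq0 -mulr2n inc_double. Qed.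
End Reduction.

Lemma inc_mul m n k (x : 'M['Z_2]_(m, n)) (f : 'M['Z_4]_(n, k)) : inc (x *m red f) = inc x *m f.
Proof. by rewrite -{1}[x]red_lift -map_mxM inc_red !mulr2n mulmxDl. Qed.

(** * Derivations modulo two *)
Lemma red_two n : red (2%:M : 'M['Z_4]_n) = 0.
Proof. by rewrite map_scalar_mx [X in X%:M](_ : _ = 0) ?raddf0 //; apply: val_inj. Qed.

(** Additivity of K is not part of the definition of a derivation, but it can be
    replaced by that of the category.  K vanishes on identities and zeros.  The
    map 2 is the fold map f after the diagonal d of Z/4 + Z/4, and f (resp. d) is
    the sum of the projections p1, p2 (resp. of the inclusions i1, i2).  Adding
    up the derivation rules for all nine products of f, p1, p2 with d, i1, i2,
    the right-hand sides cancel modulo 2, and of the left-hand sides only the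
    value at f d = 2 is left. *)
Lemma derivation_two (K : forall m n, 'M['Z_4]_(m, n) -> 'M['Z_2]_(m, n)) :
  (forall m n k (x : 'M['Z_4]_(m, n)) (y : 'M['Z_4]_(n, k)),
     K m k (x *m y) = red x *m K n k y + K m n x *m red y) ->
  K 1%N 1%N 2%:M = 0.
Proof.
move=> KM.
have K1 : K 1%N 1%N (1%:M : 'M['Z_4]_1) = 0.
  by have := KM _ _ _ (1%:M : 'M['Z_4]_1) (1%:M : 'M['Z_4]_1);
    rewrite !(mul1mx, map_mx1, mulmx1) addmx_Z2.
have K0 : K 1%N 1%N (0 : 'M['Z_4]_1) = 0.
  by have := KM _ _ _ (0 : 'M['Z_4]_1) (0 : 'M['Z_4]_1); rewrite map_mx0 !(mul0mx, mulmx0) addr0.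
pose f : 'M['Z_4]_(1, 1 + 1) := row_mx 1%:M 1%:M; pose d : 'M['Z_4]_(1 + 1, 1) := col_mx 1%:M 1%:M.
pose p1 : 'M['Z_4]_(1, 1 + 1) := row_mx 1%:M 0; pose p2 : 'M['Z_4]_(1, 1 + 1) := row_mx 0 1%:M.
pose i1 : 'M['Z_4]_(1 + 1, 1) := col_mx 1%:M 0; pose i2 : 'M['Z_4]_(1 + 1, 1) := col_mx 0 1%:M.
have fE : red f = red p1 + red p2.
  by rewrite -map_mxD add_row_mx addr0 add0r.
have dE : red d = red i1 + red i2.
  by rewrite -map_mxD add_col_mx addr0 add0r.
have comp := (@mul_row_col, mul1mx, mulmx1, mul0mx, mulmx0, addr0, add0r).
have : K 1%N 1%N (f *m d) = K 1%N 1%N 2%:M.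
  have -> : 2%:M = 1%:M + 1%:M :> 'M['Z_4]_1 by rewrite -raddfD.
  by rewrite !comp.
have R1 := KM _ _ _ p1 d; have R2 := KM _ _ _ p2 d.
have R3 := KM _ _ _ f i1; have R4 := KM _ _ _ f i2.
have R5 := KM _ _ _ p1 i1; have R6 := KM _ _ _ p1 i2.
have R7 := KM _ _ _ p2 i1; have R8 := KM _ _ _ p2 i2.
rewrite KM => <-.
move: R1 R2 R3 R4 R5 R6 R7 R8; rewrite !comp ?K1 ?K0.
clearbody p1 p2 i1 i2 f d; rewrite fE dE !mulmxDl !mulmxDr => R1 R2 R3 R4 R5 R6 R7 R8.
apply: (exp2_comb (esym R1)); apply: (exp2_comb (esym R2)).
apply: (exp2_comb (esym R3)); apply: (exp2_comb (esym R4)).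
apply: (exp2_comb (esym R5)); apply: (exp2_comb (esym R6)).
apply: (exp2_comb (esym R7)); apply: (exp2_comb (esym R8)).
exp2 (@addmx_Z2 1 1).
Qed.

(** * The bracket of 2 with itself *)

(** nu is the reduction modulo 2 of a 3-cocycle on free Z/4-modules.  Its integer
    arguments are the degrees of the three morphisms: a matrix is a morphism of
    every degree, and the value of nu may depend on the degrees.  The Koszul
    signs are invisible modulo 2. *)
Section CocycleModTwo.
Variable nu : int -> int -> int -> forall a b c d,
  'M['Z_4]_(a, b) -> 'M['Z_4]_(b, c) -> 'M['Z_4]_(c, d) -> 'M['Z_2]_(a, d).
Hypothesis nu_cocycle : forall (p q r s : int) a b c d e (f : 'M['Z_4]_(a, b)) (g : 'M['Z_4]_(b, c))
    (h : 'M['Z_4]_(c, d)) (k : 'M['Z_4]_(d, e)),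
  red f *m nu q r s g h k + nu (p + q) r s (f *m g) h k + nu p (q + r) s f (g *m h) k
  + nu p q (r + s) f g (h *m k) + nu p q r f g h *m red k = 0.

Local Notation two := (2%:M : 'M['Z_4]_1).
Local Notation nu0 := (nu 0 0 0).

Let nu0_cocycle a b c d e (f : 'M['Z_4]_(a, b)) (g : 'M['Z_4]_(b, c))
    (h : 'M['Z_4]_(c, d)) (k : 'M['Z_4]_(d, e)) :
  red f *m nu0 g h k + nu0 (f *m g) h k + nu0 f (g *m h) k
  + nu0 f g (h *m k) + nu0 f g h *m red k = 0.
Proof. by have := nu_cocycle 0 0 0 0 f g h k; rewrite !addr0. Qed.

(** The three ways of inserting x in a string with two copies of 2, as in the Toda
    bracket of x, 2, 2.  As nu is not normalised, it need not vanish on strings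
    that contain 0; the last two terms, in which 0 is factored through the zero
    object, compensate for this. *)
Definition bracket m n (x : 'M['Z_4]_(m, n)) : 'M['Z_2]_(m, n) :=
  nu0 x 2%:M 2%:M + nu0 2%:M x 2%:M + nu0 2%:M 2%:M x
  + nu0 x (0 : 'M['Z_4]_(n, 0)) (0 : 'M['Z_4]_(0, n))
  + nu0 (0 : 'M['Z_4]_(m, 0)) (0 : 'M['Z_4]_(0, m)) x.

(** Insert 2, 2 in the string x, y in the six possible ways.  In the sum of the
    corresponding cocycle relations the terms with 2 moved across x or y cancel,
    and what is left is the derivation rule for the first three terms of the
    bracket, up to the values of nu on the three strings made of x, y and 0
    = 2 . 2.  Inserting the factorisation of 0 through the zero object in
    three ways expresses these values by the last two terms of the bracket. *)
Lemma bracketM m n k (x : 'M['Z_4]_(m, n)) (y : 'M['Z_4]_(n, k)) :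
  bracket (x *m y) = red x *m bracket y + bracket x *m red y.
Proof.
pose t i : 'M['Z_4]_i := 2%:M.
have tt i : t i *m t i = 0.
  by rewrite /t -scalar_mxM [X in X%:M](_ : _ = 0) ?raddf0 //; apply: val_inj.
have tC i j (z : 'M['Z_4]_(i, j)) : z *m t j = t i *m z by rewrite /t scalar_mxC.
pose i n : 'M['Z_4]_(n, 0) := 0; pose e n : 'M['Z_4]_(0, n) := 0.
have ie j : i j *m e j = 0 by rewrite mul0mx.
have iy j l (z : 'M['Z_4]_(j, l)) : z *m i l = i j by rewrite mulmx0.
have ey j l (z : 'M['Z_4]_(j, l)) : e j *m z = e l by rewrite mul0mx.
have i0 j l (z : 'M['Z_2]_(j, 0)) : z *m red (e l) = 0 by rewrite [z]thinmx0 mul0mx.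
have e0 j l (z : 'M['Z_2]_(0, l)) : red (i j) *m z = 0 by rewrite [z]flatmx0 mulmx0.
rewrite /bracket -!/(t _) -!/(i _) -!/(e _).
have rt j : red (t j) = 0 := red_two j.
(* P1 to P6 insert 2, 2, and Q1 to Q3 insert the zero object. *)
have P1 := nu0_cocycle (t m) (t m) x y.
have P2 := nu0_cocycle (t m) x (t n) y.
have P3 := nu0_cocycle (t m) x y (t k).
have P4 := nu0_cocycle x (t n) (t n) y.
have P5 := nu0_cocycle x (t n) y (t k).
have P6 := nu0_cocycle x y (t k) (t k).
have Q1 := nu0_cocycle (i m) (e m) x y.
have Q2 := nu0_cocycle x (i n) (e n) y.
have Q3 := nu0_cocycle x y (i k) (e k).
rewrite ?(ie, iy, ey, i0, e0, tt, tC, rt, mul0mx, mulmx0, map_mx0, add0r, addr0)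
  in P1 P2 P3 P4 P5 P6 Q1 Q2 Q3.
rewrite !mulmxDl !mulmxDr.
apply: (exp2_eq (@addmx_Z2 _ _)).
apply: (exp2_comb P1); apply: (exp2_comb P2); apply: (exp2_comb P3).
apply: (exp2_comb P4); apply: (exp2_comb P5); apply: (exp2_comb P6).
apply: (exp2_comb Q1); apply: (exp2_comb Q2); apply: (exp2_comb Q3).
exp2 (@addmx_Z2 m k).
Qed.

(** The first three terms of the bracket coincide at 2, so this computes
    nu(2, 2, 2) modulo 2. *)
Lemma bracket_two : bracket two = 0.
Proof. exact: (derivation_two bracketM). Qed.

(** * A primitive modulo two on the image of inc *)
Local Notation mult2 q r y f := (nu 0 q r two y f).
Let stack n (y k : 'M['Z_4]_(1, n)) : 'M['Z_4]_(1 + 1, n) := col_mx y k.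
(** u1 and u0 send the pair (y, k) to y + 2 k and to y; they agree after
    multiplication by 2. *)
Let u1 : 'M['Z_4]_(1, 1 + 1) := row_mx 1%:M two.
Let u0 : 'M['Z_4]_(1, 1 + 1) := row_mx 1%:M 0.

Lemma two_mul n (y : 'M['Z_4]_(1, n)) : two *m y = y *+ 2.
Proof. by rewrite mul_scalar_mx scaler_nat. Qed.

Let stackM n l (y k : 'M['Z_4]_(1, n)) (f : 'M['Z_4]_(n, l)) :
  stack y k *m f = stack (y *m f) (k *m f).
Proof. exact: mul_col_mx. Qed.

Let u1_stack n (y k : 'M['Z_4]_(1, n)) : u1 *m stack y k = y + k *+ 2.
Proof. by rewrite mul_row_col mul1mx two_mul. Qed.

Let u0_stack n (y k : 'M['Z_4]_(1, n)) : u0 *m stack y k = y.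
Proof. by rewrite mul_row_col mul1mx mul0mx addr0. Qed.

Let two_u : two *m u1 = two *m u0.
Proof.
by rewrite !mul_mx_row !two_mul mul0rn; congr row_mx; apply/double_eq0/red_two.
Qed.

(** For y in Z/4, the function nu(2, y, f) is a primitive of nu(2 y, f, g).  It
    does not factor through y modulo 2, but the change from y to y + 2 k is again
    a coboundary, namely of this function of y and k. *)
Definition pre_jump q n (y k : 'M['Z_4]_(1, n)) : 'M['Z_2]_(1, n) :=
  nu 0 0 q two u1 (stack y k) + nu 0 0 q two u0 (stack y k).

Lemma pre_jump_mul (q r : int) n l (y k : 'M['Z_4]_(1, n)) (f : 'M['Z_4]_(n, l)) :
  pre_jump (q + r) (y *m f) (k *m f) + pre_jump q y k *m red f =
  mult2 q r (y + k *+ 2) f + mult2 q r y f.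
Proof.
have H1 := nu_cocycle 0 0 q r two u1 (stack y k) f.
have H0 := nu_cocycle 0 0 q r two u0 (stack y k) f.
rewrite red_two mul0mx !add0r stackM two_u u1_stack in H1.
rewrite red_two mul0mx !add0r stackM u0_stack in H0.
rewrite /pre_jump !mulmxDl.
apply: (exp2_eq (@addmx_Z2 _ _)); apply: (exp2_comb H1); apply: (exp2_comb H0).
exp2 (@addmx_Z2 1 l).
Qed.

(** The normalisation makes the jump vanish along k = 0. *)
Definition jump q n (y k : 'M['Z_4]_(1, n)) := pre_jump q y k + pre_jump q y 0.

Lemma jump_mul (q r : int) n l (y k : 'M['Z_4]_(1, n)) (f : 'M['Z_4]_(n, l)) :
  jump (q + r) (y *m f) (k *m f) + jump q y k *m red f =
  mult2 q r (y + k *+ 2) f + mult2 q r y f.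
Proof.
have H := pre_jump_mul q r y k f.
have H0 : pre_jump (q + r) (y *m f) 0 + pre_jump q y 0 *m red f = 0.
  by have := pre_jump_mul q r y 0 f; rewrite mul0mx mul0rn addr0 addmx_Z2.
rewrite -[RHS]addr0 -H0 -H /jump mulmxDl.
apply: (exp2_eq (@addmx_Z2 _ _)); exp2 (@addmx_Z2 1 l).
Qed.

Lemma jump_0 q n (y : 'M['Z_4]_(1, n)) : jump q y 0 = 0.
Proof. exact: addmx_Z2. Qed.

(** This value is the obstruction to descending the primitive to Z/2.  Two cocycle
    relations identify it with nu(2, 2, 2) + nu(2, 0, 2), and a third one with the
    bracket of 2. *)
Lemma jump_two : jump 0 0 two = 0.
Proof.
have pre_jump0 : pre_jump 0 0 (0 : 'M['Z_4]_1) = 0.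
  have := pre_jump_mul 0 0 (0 : 'M['Z_4]_1) (0 : 'M['Z_4]_1) (0 : 'M['Z_4]_1).
  by rewrite mul0rn !(map_mx0, mulmx0) add0r !addr0 addmx_Z2.
rewrite /jump pre_jump0 addr0 /pre_jump.
have e1 : stack 0 1%:M *m two = stack 0 two by rewrite stackM mul0mx mul1mx.
have H1 := nu0_cocycle two u1 (stack 0 1%:M) two.
have H0 := nu0_cocycle two u0 (stack 0 1%:M) two.
have H2 := bracket_two; rewrite /bracket in H2.
have H3 := nu0_cocycle two (0 : 'M['Z_4]_(1, 0)) (0 : 'M['Z_4]_(0, 1)) two.
have z1 : two *m (0 : 'M['Z_4]_(1, 0)) = (0 : 'M['Z_4]_(1, 0)) by rewrite mulmx0.
have z2 : (0 : 'M['Z_4]_(0, 1)) *m two = (0 : 'M['Z_4]_(0, 1)) by rewrite mul0mx.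
have z3 : (0 : 'M['Z_4]_(1, 0)) *m (0 : 'M['Z_4]_(0, 1)) = 0 :> 'M['Z_4]_1 by rewrite mul0mx.
rewrite z1 z2 z3 red_two mul0mx mulmx0 add0r addr0 in H3.
rewrite e1 u1_stack add0r two_u red_two mul0mx mulmx0 add0r addr0 in H1.
rewrite [1%:M *+ 2](_ : _ = two) in H1; last by rewrite -two_mul mulmx1.
rewrite e1 u0_stack red_two mul0mx mulmx0 add0r addr0 in H0.
apply: (exp2_comb H0); apply: (exp2_comb H1); apply: (exp2_comb H2); apply: (exp2_comb H3).
exp2 (@addmx_Z2 1 1).
Qed.

Lemma mulrn4 m n (z : 'M['Z_4]_(m, n)) : z *+ 2 *+ 2 = 0.
Proof. by apply/double_eq0; rewrite red_double. Qed.

(** Compares the jump from y to y + 2 k followed by the one to y + 2 k + 2 z with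
    the direct jump.  The multiple 2 h accounts for the fact that 2 k + 2 z does
    not determine k + z. *)
Definition jump_defect q n (y k z h : 'M['Z_4]_(1, n)) : 'M['Z_2]_(1, n) :=
  jump q (y + k *+ 2) z + jump q y k + jump q y (k + z + h *+ 2).

Lemma jump_defect_mul (q r : int) n l (y k z h : 'M['Z_4]_(1, n)) (f : 'M['Z_4]_(n, l)) :
  jump_defect (q + r) (y *m f) (k *m f) (z *m f) (h *m f) = jump_defect q y k z h *m red f.
Proof.
have e1 : y *m f + (k *m f) *+ 2 = (y + k *+ 2) *m f by rewrite !mulr2n !mulmxDl.
have e2 : k *m f + z *m f + (h *m f) *+ 2 = (k + z + h *+ 2) *m f.
  by rewrite !mulr2n !mulmxDl.
have e3 : y + (k + z + h *+ 2) *+ 2 = y + k *+ 2 + z *+ 2.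
  by rewrite mulrnDl mulrn4 addr0 mulrnDl addrA.
have H1 := jump_mul q r (y + k *+ 2) z f; have H2 := jump_mul q r y k f.
have H3 := jump_mul q r y (k + z + h *+ 2) f; rewrite e3 in H3.
rewrite /jump_defect e1 e2.
have red_sum (u v w : 'M['Z_2]_(1, n)) : (u + v + w) *m red f = u *m red f + v *m red f + w *m red f.
  by rewrite !mulmxDl.
rewrite red_sum; apply: (exp2_eq (@addmx_Z2 _ _)).
apply: (exp2_comb (exp2_sum (@addmx_Z2 _ _) H1)); apply: (exp2_comb (exp2_sum (@addmx_Z2 _ _) H2)).
apply: (exp2_comb (exp2_sum (@addmx_Z2 _ _) H3)).
exp2 (@addmx_Z2 1 l).
Qed.

(** By naturality the defect is a linear form in (y, k, z, h), so it is determined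
    by its values at the four unit vectors.  At the first three the jumps are zero
    or cancel in pairs, and at the last one the defect is jump_two. *)
Lemma jump_defect_eq0 q n (y k z h : 'M['Z_4]_(1, n)) : jump_defect q y k z h = 0.
Proof.
pose F : 'M['Z_4]_(4, n) := \matrix_i [:: y; k; z; h]`_i.
pose e i : 'M['Z_4]_(1, 4) := row i 1%:M.
have rowF i : row i F = e i *m F by rewrite -row_mul mul1mx.
suff e0 : jump_defect 0 (e 0) (e 1) (e 2%:R) (e 3%:R) = 0.
  have := jump_defect_mul 0 q (e 0) (e 1) (e 2%:R) (e 3%:R) F.
  by rewrite -!rowF !rowK add0r e0 mul0mx.
set lam := jump_defect _ _ _ _ _.
have lam0 j : lam *m red (delta_mx j 0 : 'M['Z_4]_(4, 1)) = 0.
  rewrite -(jump_defect_mul 0 0) addr0.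
  have eE i : e i *m (delta_mx j 0 : 'M['Z_4]_(4, 1)) = (i == j)%:R%:M.
    by rewrite -row_mul mul1mx; apply/matrixP => a b; rewrite !mxE !ord1 eqxx andbT.
  rewrite !eE /jump_defect.
  case: j {eE} => -[|[|[|[|//]]]] j4 /=;
    rewrite ?(raddf0, mul0rn, add0r, addr0, jump_0, addmx_Z2) //.
  by rewrite -two_mul mulmx1 jump_two.
apply/rowP => j; have /matrixP/(_ 0 0) := lam0 j.
by rewrite map_delta_mx -colE !mxE.
Qed.

(** The integer part of the discrepancy between lifting and multiplying, as in the
    addition of digits. *)
Definition carry n l (x : 'M['Z_2]_(1, n)) (f : 'M['Z_4]_(n, l)) : 'M['Z_4]_(1, l) :=
  halve (lift_mx x *m f - lift_mx (x *m red f)).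

Lemma carryE n l (x : 'M['Z_2]_(1, n)) (f : 'M['Z_4]_(n, l)) :
  lift_mx x *m f = lift_mx (x *m red f) + carry x f *+ 2.
Proof.
by rewrite double_halve ?subrKC // raddfB /= map_mxM !red_lift subrr.
Qed.

(** The primitive available on Z/4, evaluated at the lift of x, plus the jump from
    the lift of x f to the lift of x times f. *)
Definition primitive (p q : int) n l (x : 'M['Z_2]_(1, n)) (f : 'M['Z_4]_(n, l)) :
    'M['Z_2]_(1, l) :=
  mult2 p q (lift_mx x) f + jump (p + q) (lift_mx (x *m red f)) (carry x f).

(** Moving the lift of x by f and then g, or by f g, gives two chains of jumps
    between the same elements, whose comparison is jump_defect. *)
Lemma primitive_cobounds (p q r : int) n l m (x : 'M['Z_2]_(1, n)) (f : 'M['Z_4]_(n, l))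
    (g : 'M['Z_4]_(l, m)) :
  nu p q r (inc x) f g =
  primitive (p + q) r (x *m red f) g + primitive p (q + r) x (f *m g)
  + primitive p q x f *m red g.
Proof.
have H1 := nu_cocycle 0 p q r two (lift_mx x) f g.
rewrite red_two mul0mx !add0r in H1.
have e1 : two *m lift_mx x = inc x by exact: two_mul.
rewrite e1 in H1.
have H2 := jump_mul (p + q) r (lift_mx (x *m red f)) (carry x f) g.
rewrite -carryE in H2.
(* Both sides have the same double, hence differ by an even matrix. *)
have [h hE] : exists h, carry x (f *m g) = carry (x *m red f) g + carry x f *m g + h *+ 2.
  exists (halve (carry x (f *m g) - (carry (x *m red f) g + carry x f *m g))).
  rewrite double_halve ?subrKC //; apply/double_eq0; apply/eqP.
  rewrite mulrnBl subr_eq0 mulrnDl; apply/eqP.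
  apply: (addrI (lift_mx (x *m red (f *m g)))); rewrite -carryE mulmxA carryE mulmxDl.
  by rewrite map_mxM mulmxA carryE -addrA !mulr2n mulmxDl.
have H3 := jump_defect_eq0 (p + q + r) (lift_mx (x *m red f *m red g)) (carry (x *m red f) g)
  (carry x f *m g) h.
rewrite /jump_defect -hE -carryE in H3.
have e2 : x *m red (f *m g) = x *m red f *m red g by rewrite map_mxM mulmxA.
have e3 : primitive p q x f *m red g =
    mult2 p q (lift_mx x) f *m red g + jump (p + q) (lift_mx (x *m red f)) (carry x f) *m red g.
  by rewrite mulmxDl.
have eD : p + (q + r) = p + q + r by rewrite addrA.
rewrite e3 /primitive e2 eD; apply: (exp2_eq (@addmx_Z2 _ _)).
apply: (exp2_comb H1); apply: (exp2_comb (exp2_sum (@addmx_Z2 _ _) H2)); apply: (exp2_comb H3).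
exp2 (@addmx_Z2 1 m).
Qed.

End CocycleModTwo.

(** * Division by two *)
Lemma sign_int (k : int) : (-1 : int) ^ k = 1 \/ (-1 : int) ^ k = -1.
Proof.
have sign_nat n : (-1 : int) ^+ n = 1 \/ (-1 : int) ^+ n = -1.
  by rewrite -signr_odd; case: odd; [right | left].
case: k => n; rewrite /exprz; first exact: sign_nat.
by have [] := sign_nat n.+1 => ->; [left | right].
Qed.

(** The b_i are the terms of the coboundary of a coboundary. *)
Lemma cobound_cancel m n (t u v w x b1 b2 b3 b4 b5 b6 : 'M['Z_4]_(m, n)) :
  t - (u - (b1 - b2 + b3) - (v - (b1 - b4 + b5)) + (w - (b2 - b4 + b6))
       - (x - (b3 - b5 + b6))) = t - u + v - w + x.
Proof. by apply/matrixP => i j; rewrite !mxE; ring. Qed.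

Section Cocycle.
Variable mu : int -> int -> int -> forall a b c d,
  'M['Z_4]_(a, b) -> 'M['Z_4]_(b, c) -> 'M['Z_4]_(c, d) -> 'M['Z_4]_(a, d).
Hypothesis mu_cocycle : forall (p q r s : int) a b c d e (f : 'M['Z_4]_(a, b)) (g : 'M['Z_4]_(b, c))
    (h : 'M['Z_4]_(c, d)) (k : 'M['Z_4]_(d, e)),
  (f *m mu q r s g h k) *~ (-1) ^ (-1 * p) - mu (p + q) r s (f *m g) h k
  + mu p (q + r) s f (g *m h) k - mu p q (r + s) f g (h *m k) + mu p q r f g h *m k = 0.

Let nu (p q r : int) a b c d (f : 'M['Z_4]_(a, b)) (g : 'M['Z_4]_(b, c)) 
    (h : 'M['Z_4]_(c, d)) := red (mu p q r f g h).

Lemma mu_cocycle_red (p q r s : int) a b c d e (f : 'M['Z_4]_(a, b)) (g : 'M['Z_4]_(b, c))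
    (h : 'M['Z_4]_(c, d)) (k : 'M['Z_4]_(d, e)) :
  red f *m nu q r s g h k + nu (p + q) r s (f *m g) h k + nu p (q + r) s f (g *m h) k
  + nu p q (r + s) f g (h *m k) + nu p q r f g h *m red k = 0.
Proof.
have := congr1 (fun z => red z) (mu_cocycle p q r s f g h k).
rewrite map_mx0 !(raddfD, raddfN) /= !map_mxM !oppmx_Z2 raddfMz /= map_mxM.
by case: (sign_int (-1 * p)) => ->; rewrite ?mulr1z // mulrN1z oppmx_Z2.
Qed.

Definition cochain2 := int -> int -> int -> forall n l m,
  'M['Z_2]_(1, n) -> 'M['Z_4]_(n, l) -> 'M['Z_4]_(l, m) -> 'M['Z_2]_(1, m).

(** By primitive_cobounds mu(inc x, f, g) is modulo 2 the coboundary of a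
    1-cochain; beta lifts this cochain to Z/4 and c is the quotient by inc of the
    remaining even cochain.  This is how a connecting morphism is computed. *)
Definition halves (beta : int -> int -> forall n l, 'M['Z_2]_(1, n) -> 'M['Z_4]_(n, l) ->
    'M['Z_4]_(1, l)) (c : cochain2) := forall (p q r : int) n l m
    (x : 'M['Z_2]_(1, n)) (f : 'M['Z_4]_(n, l)) (g : 'M['Z_4]_(l, m)),
  inc (c p q r n l m x f g) = mu p q r (inc x) f g
    - (beta (p + q) r l m (x *m red f) g - beta p (q + r) n m x (f *m g) + beta p q n l x f *m g).

Lemma exists_halves : exists beta c, halves beta c.
Proof.
pose beta (p q : int) n l (x : 'M['Z_2]_(1, n)) (f : 'M['Z_4]_(n, l)) := lift_mx (primitive nu p q x f).
exists beta; exists (fun p q r n l m x f g => red (halve (mu p q r (inc x) f g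
    - (beta (p + q) r l m (x *m red f) g - beta p (q + r) n m x (f *m g) + beta p q n l x f *m g)))).
move=> p q r n l m x f g; rewrite inc_halve // !(raddfD, raddfN) /= map_mxM !red_lift.
rewrite -/(nu p q r (inc x) f g) (primitive_cobounds mu_cocycle_red) !oppmx_Z2.
exact: addmx_Z2.
Qed.

(** It suffices to compare after inc, where the coboundary of beta disappears and
    the cocycle condition for mu at inc x, f, g, h remains.  The signs do not
    matter because the image of inc has exponent 2. *)
Lemma halves_cobounds beta (c : cochain2) (p q r s : int) n l m o (x : 'M['Z_2]_(1, n))
    (f : 'M['Z_4]_(n, l)) (g : 'M['Z_4]_(l, m)) (h : 'M['Z_4]_(m, o)) : halves beta c ->
  (x *m red (mu q r s f g h)) *~ (-1) ^ (-1 * p) =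
  c (p + q) r s _ _ _ (x *m red f) g h - c p (q + r) s _ _ _ x (f *m g) h
  + c p q (r + s) _ _ _ x f (g *m h) - c p q r _ _ _ x f g *m red h.
Proof.
move=> cE; apply: inc_inj.
have -> : inc ((x *m red (mu q r s f g h)) *~ (-1) ^ (-1 * p)) =
          (inc x *m mu q r s f g h) *~ (-1) ^ (-1 * p).
  by case: (sign_int (-1 * p)) => ->; rewrite ?mulr1z ?mulrN1z ?oppmx_Z2 -inc_mul ?incN.
have incB (u v : 'M['Z_2]_(1, o)) : inc (u - v) = inc u - inc v.
  by rewrite oppmx_Z2 incD incN.
rewrite incB incD incB inc_mul.
rewrite !cE.
have := mu_cocycle p q r s (inc x) f g h.
have e1 : inc (x *m red f) = inc x *m f by exact: inc_mul.
have e2 : x *m red (f *m g) = x *m red f *m red g by rewrite map_mxM mulmxA.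
have e3 : p + (q + r) = p + q + r by rewrite addrA.
have e4 : q + (r + s) = q + r + s by rewrite addrA.
rewrite e1 e2 e3 e4 -!mulmxA.
have mulmx4 (t u v w : 'M['Z_4]_(1, m)) :
    (t - (u - v + w)) *m h = t *m h - (u *m h - v *m h + w *m h).
  by rewrite mulmxBl mulmxDl mulmxBl.
rewrite mulmx4 => H; apply/eqP; rewrite -subr_eq0 -H; apply/eqP.
rewrite -!mulmxA; exact: cobound_cancel.
Qed.

End Cocycle.

(** * Modules on which the class of xi vanishes *)

(** The class of xi m in Ext^{n+1,r}(M, M) is zero. *)
Definition null C r n (m : hcochain (reg C) n.+1 r) (M : rmod C) :=
  exists psi : vcochain M M n r, dV n r psi = xi m M.

(** An element x of the free module on X is a morphism, and xi m at x, f_1, ...,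
    f_{n+1} is the first term of the cocycle condition of m at this string.  The
    other terms are minus the coboundary of m, with x as the module argument. *)
Lemma null_rep C r n (m : hcochain (reg C) n.+1 r) (X : C) :
  dH n.+1 r m = 0 -> null m (rep X).
Proof.
move=> m0; exists (fun x : elt (rep X) r => m X (Arrow (evl x : mor (edeg x) (eob x) X) (eoutE x))).
apply: dfunP => x; pose a := Arrow (evl x : mor (edeg x) (eob x) X) (eoutE x).
have : dH n.+1 r m X a = 0 by rewrite m0.
rewrite -[LHS]/(dhead m X a + dtail (m X) a) dtailS -opprD.
by move/eqP; rewrite subr_eq0 => /eqP H; exact: (esym H).
Qed.

Lemma lmap_sum (C : gcat) (M N : rmod C) d (I : finType)
    (h : I -> forall Y r t, d + r = t -> M Y r -> N Y t) n X s t (e : d + s = t)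
    (phi : cochain M n X s) :
  \sum_k lmap (h k) e phi = lmap (fun Y r t e x => \sum_k h k Y r t e x) e phi.
Proof.
elim: n X s t e phi => //= n IHn X s t e phi.
by apply: dfunP => a; rewrite dfun_sumE; apply: IHn.
Qed.

(** By naturality of xi, the primitive on M is the sum of the primitives on the
    L k, transported along i k and p k.  The additivity that enters is the one of
    postcomposition, which already holds for cochains. *)
Lemma null_retract C r n (m : hcochain (reg C) n.+1 r) (M : rmod C) (I : finType)
    (L : I -> rmod C) (i : forall k, ghom (L k) M 0) (p : forall k, ghom M (L k) 0) :
  linear_rmod M -> (forall k, linear_rmod (L k)) ->
  (forall X s (e : 0 + s = s) (x : M X s), \sum_k i k s s X e (p k s s X e x) = x) ->
  (forall k, null m (L k)) -> null m M.
Proof.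
move=> M_lin L_lin ip L_null; pose psi k := projT1 (cid (L_null k)).
exists (\sum_k vpost (add0r r) (i k) (vpre (addr0 r) (p k) (psi k))).
rewrite raddf_sum; transitivity (\sum_k vpost (add0r r) (i k)
    (vpost (add0r r) (p k) (xi m M))).
  apply: eq_bigr => k _ /=; rewrite dV_vpost dV_vpre (projT2 (cid (L_null k))).
  by rewrite -(xi_natural M_lin (L_lin k) (addr0 r) (add0r r)) mulr0 expr0z mulr1z.
pose h k Y a b (ab : 0 + a = b) (y : M Y a) := i k a b Y ab (p k a a Y (add0r a) y).
have key X u (phi : cochain M n.+1 X u) (e : 0 + u = u) :
    \sum_k lmap (ghmap (i k)) e (lmap (ghmap (p k)) e phi) = phi.
  transitivity (\sum_k lmap (h k) e phi).
    apply: eq_bigr => k _; apply: lmap_comp => Y a b c e1 e2 e3 y; rewrite /ghmap /h.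
    have ab := etrans (esym (add0r a)) e1.
    by case: _ / ab e1 e2 => e1 e2; rewrite (int_irr e1 (add0r a)) (int_irr e2 e3).
  rewrite lmap_sum; apply: lmap_id => Y a ea y.
  by rewrite /h (int_irr ea (add0r a)); apply: ip.
apply: dfunP => -[X s x u e]; rewrite dfun_sumE; case: _ / e; exact: key.
Qed.

(** * The module Z/2 *)

(** The Z/4-module Z/2 as a module over T_Sigma, the same in every degree: its
    value at (Z/4)^n is Hom((Z/4)^n, Z/2). *)
Definition Z2mod : rmod T_Sigma.
Proof.
refine (@RMod T_Sigma (fun n _ => 'M['Z_2]_(1, n)) (fun p q t n l _ x f => x *m red f) _ _ _).
- by move=> p q t X Y _ x y f; apply: mulmxDl.
- by move=> p q r s t u X Y Z e1 e2 e3 e4 x f g; rewrite -mulmxA /= -map_mxM.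
- by move=> p X _ x; rewrite map_mx1; apply: mulmx1.
Defined.

Lemma Z2mod_linear : linear_rmod Z2mod.
Proof. by move=> p q t X Y e x f g; rewrite /= map_mxD; apply: mulmxDr. Qed.

Section ThreeCocycle.
Variables (m : hcochain (reg T_Sigma) 3 (-1)) (m0 : dH 3 (-1) m = 0).

(** A matrix does not know its degree, which therefore has to be given. *)
Let arr (s p : int) (a b : nat) (f : 'M['Z_4]_(a, b)) (t : int) (e : s + p = t) :=
  @Arrow T_Sigma a s b p f t e.

Definition value (p q r : int) a b c d (f : 'M['Z_4]_(a, b)) (g : 'M['Z_4]_(b, c))
    (h : 'M['Z_4]_(c, d)) : 'M['Z_4]_(a, d) :=
  @m a (arr f (erefl (-1 + p))) (arr g (erefl (-1 + p + q))) (arr h (erefl (-1 + p + q + r))).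

(** The group of values of m does not depend on the output degree, so that the
    equations between degrees carry no information. *)
Lemma valueE (p q r t u v : int) a b c d (f : 'M['Z_4]_(a, b)) (g : 'M['Z_4]_(b, c))
    (h : 'M['Z_4]_(c, d)) (e1 : -1 + p = t) (e2 : t + q = u) (e3 : u + r = v) :
  @m a (arr f e1) (arr g e2) (arr h e3) = value p q r f g h.
Proof. by case: _ / e1 e2 => e2; case: _ / e2 e3 => e3; case: _ / e3. Qed.

Lemma value_cocycle (p q r s : int) a b c d e (f : 'M['Z_4]_(a, b)) (g : 'M['Z_4]_(b, c))
    (h : 'M['Z_4]_(c, d)) (k : 'M['Z_4]_(d, e)) :
  (f *m value q r s g h k) *~ (-1) ^ (-1 * p) - value (p + q) r s (f *m g) h k
  + value p (q + r) s f (g *m h) k - value p q (r + s) f g (h *m k)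
  + value p q r f g h *m k = 0.
Proof.
pose A1 := arr f (erefl (-1 + p)); pose A2 := arr g (erefl (-1 + p + q)).
pose A3 := arr h (erefl (-1 + p + q + r)); pose A4 := arr k (erefl (-1 + p + q + r + s)).
have : dH 3 (-1) m a A1 A2 A3 A4 = 0 by rewrite m0.
have t0 : dtail (@m a A1 A2 A3 : cochain (reg T_Sigma a) 0 d _) A4 = - (value p q r f g h *m k).
  by rewrite dtail0E.
have s1 : shift (@m a A1 A2 : cochain (reg T_Sigma a) 1 c _) A3 A4 = value p q (r + s) f g (h *m k).
  exact: (valueE f g (h *m k : 'M['Z_4]_(c, e)) erefl erefl (deg_comp (aoutE A3) (aoutE A4))).
have s2 : shift (@m a A1 : cochain (reg T_Sigma a) 2 b _) A2 A3 A4 = value p (q + r) s f (g *m h) k.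
  exact: (valueE f (g *m h) k erefl (deg_comp (aoutE A2) (aoutE A3)) erefl).
have s3 : shift (@m a) A1 A2 A3 A4 = value (p + q) r s (f *m g) h k.
  exact: (valueE (f *m g) h k (deg_comp (aoutE A1) (aoutE A2)) erefl erefl).
have t1 : dtail (@m a A1 A2 : cochain (reg T_Sigma a) 1 c _) A3 A4 =
    - value p q (r + s) f g (h *m k) + value p q r f g h *m k.
  by rewrite dtailS -[LHS]/(- shift (@m a A1 A2 : cochain (reg T_Sigma a) 1 c _) A3 A4
    - dtail (@m a A1 A2 A3 : cochain (reg T_Sigma a) 0 d _) A4) s1 t0 opprK.
have t2 : dtail (@m a A1 : cochain (reg T_Sigma a) 2 b _) A2 A3 A4 =
    - value p (q + r) s f (g *m h) k + value p q (r + s) f g (h *m k) - value p q r f g h *m k.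
  by rewrite dtailS -[LHS]/(- shift (@m a A1 : cochain (reg T_Sigma a) 2 b _) A2 A3 A4
    - dtail (@m a A1 A2 : cochain (reg T_Sigma a) 1 c _) A3 A4) s2 t1 opprD opprK addrA.
have t3 : dtail (@m a) A1 A2 A3 A4 = - value (p + q) r s (f *m g) h k
    + value p (q + r) s f (g *m h) k - value p q (r + s) f g (h *m k) + value p q r f g h *m k.
  by rewrite dtailS -[LHS]/(- shift (@m a) A1 A2 A3 A4
    - dtail (@m a A1 : cochain (reg T_Sigma a) 2 b _) A2 A3 A4) s3 t2 !opprD !opprK !addrA.
have t4 : dhead m a A1 A2 A3 A4 = (f *m value q r s g h k) *~ (-1) ^ (-1 * p).
  by rewrite /dhead !dfun_mulrzE.
by rewrite -[LHS]/(dhead m a A1 A2 A3 A4 + dtail (@m a) A1 A2 A3 A4) t4 t3 !addrA => <-.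
Qed.

Lemma Z2mod_null : null m Z2mod.
Proof.
have [beta [c cE]] := exists_halves value_cocycle.
pose psi : vcochain Z2mod Z2mod 2 (-1) := fun x A1 A2 =>
  c (edeg x) (adeg A1) (adeg A2) _ _ _ (evl x : 'M['Z_2]_(1, eob x)) (amor A1) (amor A2).
exists psi; apply: dfunP => -[X p x d0 E0]; apply: dfunP => -[Y q f d1 E1].
apply: dfunP => -[Z r g d2 E2]; apply: dfunP => -[W s h d3 E3].
set x0 := Elt _ _; set A1 := Arrow f E1; set A2 := Arrow g E2; set A3 := Arrow h E3.
have t0 : dtail (psi x0 A1 A2 : cochain Z2mod 0 Z _) A3 = - (c p q r _ _ _ x f g *m red h).
  by rewrite dtail0E.
have t1 : dtail (psi x0 A1 : cochain Z2mod 1 Y _) A2 A3 =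
    - c p q (r + s) _ _ _ x f (g *m h) + c p q r _ _ _ x f g *m red h.
  by rewrite dtailS -[LHS]/(- c p q (r + s) _ _ _ x f (g *m h)
    - dtail (psi x0 A1 A2 : cochain Z2mod 0 Z _) A3) t0 opprK.
have t2 : dtail (psi x0 : cochain Z2mod 2 X _) A1 A2 A3 = - c p (q + r) s _ _ _ x (f *m g) h
    + c p q (r + s) _ _ _ x f (g *m h) - c p q r _ _ _ x f g *m red h.
  by rewrite dtailS -[LHS]/(- c p (q + r) s _ _ _ x (f *m g) h
    - dtail (psi x0 A1 : cochain Z2mod 1 Y _) A2 A3) t1 opprD opprK addrA.
rewrite -[LHS]/(c (p + q) r s _ _ _ (x *m red f) g h
  + dtail (psi x0 : cochain Z2mod 2 X _) A1 A2 A3) t2 !addrA.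
rewrite -(halves_cobounds value_cocycle p q r s x f g h cE) /xi !dfun_mulrzE.
by [].
Qed.
End ThreeCocycle.

(** * Diagonalisation over Z/4 *)

(** A matrix over Z/4 lifts to an integer matrix, and the Smith normal form of the
    lift can be reduced modulo 4. *)
Lemma Z4_Smith m n (A : 'M['Z_4]_(m, n)) :
  exists (L : 'M['Z_4]_m) (R : 'M['Z_4]_n) (d : nat -> 'Z_4),
  [/\ L \in unitmx, R \in unitmx &
      A = L *m (\matrix_(i, j) (d i *+ (i == j :> nat))) *m R].
Proof.
pose f : int -> 'Z_4 := intr.
pose M : 'M[int]_(m, n) := map_mx (fun a : 'Z_4 => (a : nat)%:Z) A.
have [L Lu [R Ru [d _ ME]]] := int_Smith_normal_form M.
exists (map_mx intr L), (map_mx intr R), (fun i => (d`_i)%:~R); split.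
- by rewrite unitmxE det_map_mx rmorph_unit -?unitmxE.
- by rewrite unitmxE det_map_mx rmorph_unit -?unitmxE.
have -> : A = map_mx intr M.
  by apply/matrixP => i j; rewrite !mxE -[LHS]natr_Zp.
rewrite ME !map_mxM; congr (_ *m _ *m _); apply/matrixP => i j.
by rewrite !mxE raddfMn.
Qed.

(** In the basis given by L the column space of A is described one coordinate at
    a time: the i-th coordinate has to be a multiple of d i. *)
Lemma Z4_diagonal m n (A : 'M['Z_4]_(m, n)) :
  exists (L L' : 'M['Z_4]_m) (d : 'I_m -> 'Z_4), L *m L' = 1%:M /\
  forall k (x : 'M['Z_4]_(m, k)), (exists h, x = A *m h) <->
    forall i, exists y, row i (L' *m x) = d i *: y.
Proof.
have [L [R [d [Lu Ru AE]]]] := Z4_Smith A; set D := \matrix_(i, j) _ in AE.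
(* A row beyond the last column contains no diagonal entry. *)
pose d' i := if (i < n)%N then d i else 0.
exists L, (invmx L), (fun i => d' (val i)); split=> [|k x]; first exact: mulmxV.
have rowD (z : 'M['Z_4]_(n, k)) (i : 'I_m) :
    row i (D *m z) = d' i *: \row_l (if insub (val i) is Some j then z j l else 0).
  apply/rowP => l; rewrite !mxE /d'; case: insubP => [j jn ji|/negbTE nin]; last first.
    rewrite nin mul0r big1 // => j _; rewrite !mxE; case: eqP => [ij|_]; last by rewrite mul0r.
    by move: (ltn_ord j); rewrite -ij nin.
  rewrite jn (bigD1 j) //= !mxE ji eqxx mulr1n big1 ?addr0 // => j' j'j.
  rewrite !mxE; case: eqP => [ij|_]; last by rewrite mul0r.
  by case/eqP: j'j; apply: val_inj; rewrite /= ji.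
split=> [[h ->] i|dx].
  by exists (\row_l (if insub (val i) is Some j then (R *m h) j l else 0));
    rewrite AE -!mulmxA (mulKmx Lu) rowD.
have [y yE] := fin_all_exists dx.
pose z : 'M['Z_4]_(n, k) := \matrix_(j, l) (if insub (val j) is Some i then y i 0 l else 0).
exists (invmx R *m z); rewrite AE -!mulmxA (mulKVmx Ru).
have -> : D *m z = invmx L *m x; last by rewrite mulKVmx.
apply/row_matrixP => i; rewrite rowD yE; case: (ltnP i n) => [ltin|lein].
  congr (_ *: _); apply/rowP => l; rewrite !mxE insubT /= !mxE.
  case: insubP => [i' _ /val_inj ->|] //=; last by rewrite ltn_ord.
by rewrite /d' ltnNge lein !scale0r.
Qed.

(** * Finitely presented modules as cokernels *)
Section Cokernel.
Variable P : pres T_Sigma.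
Let g (i : 'I_(ngen P)) : nat := gob i.
Let r (j : 'I_(nrel P)) : nat := rob j.

Definition ngens : nat := (\sum_(i < ngen P) g i)%N.
Definition nrels : nat := (\sum_(j < nrel P) r j)%N.
(** Degrees being irrelevant in T_Sigma, a presentation amounts to one matrix over
    Z/4, and the module is its cokernel in every degree. *)
Definition relmx : 'M['Z_4]_(ngens, nrels) :=
  \mxblock_(i < ngen P, j < nrel P) (relc j i : 'M['Z_4]_(g i, r j)).

Definition gen (X : nat) (p : int) (z : 'M['Z_4]_(ngens, X)) : pmod P X p :=
  \pi_(pcar P X p) (fun i => submxcol z i : @mor T_Sigma (p - gdeg i) X (gob i)).

(** Coordinates of an arbitrary representative, hence additive and linear only
    modulo the relations. *)
Definition coord (X : nat) (p : int) (x : pmod P X p) : 'M['Z_4]_(ngens, X) :=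
  \mxcol_(i < ngen P) ((repr x : pfree P X p) i : 'M['Z_4]_(g i, X)).

Lemma genK X p (x : pmod P X p) : gen p (coord x) = x.
Proof.
rewrite /gen /coord -[RHS]reprK; congr \pi_ _; apply: dfunP => i; exact: mxcolK.
Qed.

Lemma genD X p : {morph @gen X p : x y / x + y}.
Proof.
move=> x y; rewrite /gen -raddfD; congr \pi_ _; apply: dfunP => i.
exact: submxcolD.
Qed.

Lemma gen0 X p : gen p (0 : 'M['Z_4]_(ngens, X)) = 0.
Proof. by apply: (addrI (gen p 0)); rewrite -genD !addr0. Qed.

Lemma gen_act X Y (p q t : int) (e : p + q = t) (z : 'M['Z_4]_(ngens, X)) (f : 'M['Z_4]_(X, Y)) :
  ract (pmod P) e (gen p z) (f : @mor T_Sigma q Y X) = gen t (z *m f).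
Proof.
rewrite /gen [LHS]pactE; congr \pi_ _; apply: dfunP => i.
exact: submxcol_mul.
Qed.

Lemma gen_eq X p (z z' : 'M['Z_4]_(ngens, X)) :
  gen p z = gen p z' <-> exists h, z - z' = relmx *m h.
Proof.
split=> [/eqP|[h zh]].
  rewrite -Quotient.idealrBE unfold_in => /asboolP[h hE].
  exists (\mxcol_j (h j : 'M['Z_4]_(r j, X))).
  rewrite mul_mxblock_mxrow -[LHS]submxcolK; apply/eq_mxcolP => i.
  by rewrite submxcolB; apply: hE.
apply/eqP; rewrite -Quotient.idealrBE unfold_in; apply/asboolP.
exists (fun j => submxcol h j : @mor T_Sigma (p - rdeg j) X (rob j)) => i.
rewrite -[LHS]/(submxcol z i - submxcol z' i) -submxcolB zh.
by rewrite -[h in LHS]submxcolK mul_mxblock_mxrow mxcolK.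
Qed.

Section OutOfCokernel.
Variables (N : rmod T_Sigma) (phi : forall X (p : int), 'M['Z_4]_(ngens, X) -> N X p).
Hypothesis phiD : forall X p, {morph @phi X p : x y / x + y}.
Hypothesis phi_act : forall X Y (p q t : int) (e : p + q = t) z (f : 'M['Z_4]_(X, Y)),
  @phi Y t (z *m f) = ract N e (@phi X p z) (f : @mor T_Sigma q Y X).
Hypothesis phi_rel : forall X p h, @phi X p (relmx *m h) = 0.

Fact coord_gen X p t (z : 'M['Z_4]_(ngens, X)) : @phi X t (coord (gen p z)) = @phi X t z.
Proof.
have [h zh] := (gen_eq p (coord (gen p z)) z).1 (genK _).
by rewrite -[coord _](subrK z) phiD zh phi_rel add0r.
Qed.

Definition coker_out : ghom (pmod P) N 0.
Proof.
refine (@GHom T_Sigma (pmod P) N 0 (fun p t X e x => @phi X t (coord x)) _ _).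
- by move=> p t X e x y; rewrite -{1}[x]genK -{1}[y]genK -genD coord_gen phiD.
- move=> p q s t u X Y e1 e2 e3 e4 x f.
  by rewrite -{1}[x]genK gen_act coord_gen; apply: phi_act.
Defined.
End OutOfCokernel.

(** psi may be a section without any additivity, such as lift_mx, as long as its
    failure to be linear lies in the relations. *)
Definition coker_in (N : rmod T_Sigma)
    (psi : forall X (p : int), N X p -> 'M['Z_4]_(ngens, X))
    (psiD : forall X p x y, exists h, psi X p (x + y) - (psi X p x + psi X p y) = relmx *m h)
    (psi_act : forall X Y (p q t : int) (e : p + q = t) x (f : 'M['Z_4]_(X, Y)), exists h,
       psi Y t (ract N e x (f : @mor T_Sigma q Y X)) - psi X p x *m f = relmx *m h) :
  ghom N (pmod P) 0.
Proof.
refine (@GHom T_Sigma N (pmod P) 0 (fun p t X e x => gen t (psi X p x)) _ _).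
- by move=> p t X e x y; rewrite -genD; apply/gen_eq; apply: psiD.
- move=> p q s t u X Y e1 e2 e3 e4 x f.
  by rewrite gen_act; apply/gen_eq; apply: psi_act.
Defined.

Definition factors_through (N : rmod T_Sigma) (E : 'M['Z_4]_ngens) : Prop :=
  exists (i : ghom N (pmod P) 0) (p : ghom (pmod P) N 0),
    forall (X : nat) s (e : 0 + s = s) (x : pmod P X s),
      i s s X e (p s s X e x) = gen s (E *m coord x).

(** In a diagonal presentation these are the columns v of L and rows w of its
    inverse that belong to a diagonal entry 0, and in the next lemma to an entry
    2. *)
Lemma factors_through_rep (v : 'M['Z_4]_(ngens, 1)) (w : 'M['Z_4]_(1, ngens)) :
  (forall X (h : 'M['Z_4]_(nrels, X)), w *m (relmx *m h) = 0) ->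
  factors_through (rep (1%N : T_Sigma)) (v *m w).
Proof.
move=> w_rel; unshelve eexists.
  apply: (@coker_in (rep (1%N : T_Sigma)) (fun X p (y : 'M['Z_4]_(1, X)) => v *m y)).
  - by move=> X p x y; exists 0; rewrite mulmxDr subrr mulmx0.
  - by move=> X Y p q t e x f; exists 0; rewrite mulmx0 /= mulmxA subrr.
unshelve eexists.
  apply: (@coker_out (rep (1%N : T_Sigma)) (fun X p z => w *m z : 'M['Z_4]_(1, X))).
  - by move=> X p x y; apply: mulmxDr.
  - by move=> X Y p q t e z f; apply: mulmxA.
  - by move=> X p h; apply: w_rel.
by move=> X s e x; rewrite -mulmxA.
Qed.

Lemma factors_through_Z2mod (v : 'M['Z_4]_(ngens, 1)) (w : 'M['Z_4]_(1, ngens)) :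
  (forall X (h : 'M['Z_4]_(nrels, X)), red (w *m (relmx *m h)) = 0) ->
  (forall X (z : 'M['Z_4]_(1, X)), red z = 0 -> exists h, v *m z = relmx *m h) ->
  factors_through Z2mod (v *m w).
Proof.
move=> w_rel v_rel; unshelve eexists.
  apply: (@coker_in Z2mod (fun X p (y : 'M['Z_2]_(1, X)) => v *m lift_mx y)).
  - move=> X p x y; rewrite -mulmxDr -mulmxBr; apply: v_rel.
    by rewrite raddfB raddfD /= !red_lift subrr.
  - move=> X Y p q t e x f; rewrite -mulmxA -mulmxBr; apply: v_rel.
    by rewrite raddfB /= map_mxM !red_lift subrr.
unshelve eexists.
  apply: (@coker_out Z2mod (fun X p z => red (w *m z) : 'M['Z_2]_(1, X))).
  - by move=> X p x y; rewrite mulmxDr raddfD.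
  - by move=> X Y p q t e z f; rewrite mulmxA map_mxM.
  - by move=> X p h; apply: w_rel.
move=> X s e x; apply/gen_eq; rewrite -mulmxA -mulmxBr; apply: v_rel.
by rewrite raddfB /= red_lift; apply: subrr.
Qed.

Lemma factors_through_0 (N : rmod T_Sigma) (E : 'M['Z_4]_ngens) :
  (forall X (z : 'M['Z_4]_(ngens, X)), exists h, E *m z = relmx *m h) -> factors_through N E.
Proof.
move=> E_rel; exists 0, 0 => X s e x; have [h zh] := E_rel X (coord x).
rewrite -[LHS](gen0 X s); apply/gen_eq.
by exists (- h); rewrite mulmxN -zh sub0r.
Qed.

End Cokernel.

Lemma Z4_cases (d : 'Z_4) : [\/ d = 0, d = 2%:R | exists u, d * u = 1].
Proof.
case: d => -[|[|[|[|//]]]] d4; [constructor 1|constructor 3|constructor 2|constructor 3];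
  try exact: val_inj; [exists 1 | exists 3%:R]; exact: val_inj.
Qed.

(** In diagonal form the module is the direct sum of the cyclic modules Z/4 modulo
    d k.  The identity is the sum of the endomorphisms given by column k of L times
    row k of L', and these factor through Z/4 if d k is 0, through Z/2 if d k is
    2, and vanish if d k is a unit. *)
Lemma pmod_null (P : pres T_Sigma) (m : hcochain (reg T_Sigma) 3 (-1)) :
  dH 3 (-1) m = 0 -> null m (pmod P).
Proof.
move=> m0; have [L [L' [d [LL' dP]]]] := Z4_diagonal (relmx P).
have colL X k (y w : 'M['Z_4]_(1, X)) : y = d k *: w -> exists h, col k L *m y = relmx P *m h.
  move=> yw; apply/(dP X) => i; exists ((i == k)%:R *: w).
  rewrite mulmxA colE [L' *m _]mulmxA (mulmx1C LL') mul1mx row_mul.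
  have -> : row i (delta_mx k 0) = (i == k)%:R%:M :> 'M['Z_4]_1.
    by apply/matrixP => a b; rewrite !mxE !ord1 eqxx andbT mulr1n.
  rewrite mul_scalar_mx yw; have [->|_] := eqVneq i k; first by rewrite !scale1r.
  by rewrite !scale0r scaler0.
have rowL X k (h : 'M['Z_4]_(_, X)) : exists y, row k L' *m (relmx P *m h) = d k *: y.
  by rewrite -row_mul; apply: (dP X _).1; exists h.
have rep_lin : linear_rmod (rep (1%N : T_Sigma)) by move=> *; apply: mcompDr.
have sum k : exists N, [/\ linear_rmod N, null m N & factors_through N (col k L *m row k L')].
  have [dk0|dk2|[u du]] := Z4_cases (d k).
  - exists (rep (1%N : T_Sigma)); split=> //; first exact: null_rep.
    by apply: factors_through_rep => X h; have [y ->] := rowL X k h; rewrite dk0 scale0r.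
  - exists Z2mod; split; [exact: Z2mod_linear | exact: Z2mod_null |].
    apply: factors_through_Z2mod => [X h|X z /double_halve zE].
      by have [y ->] := rowL X k h; rewrite dk2 scaler_nat; apply: red_double.
    by apply: (colL X k z (halve z)); rewrite dk2 scaler_nat zE.
  - exists (rep (1%N : T_Sigma)); split=> //; first exact: null_rep.
    apply: factors_through_0 => X z; rewrite -mulmxA.
    by apply: (colL _ _ _ (u *: (row k L' *m z))); rewrite scalerA du scale1r.
pose N k := projT1 (cid (sum k)).
have N_lin k : linear_rmod (N k) by case: (projT2 (cid (sum k))).
have N_null k : null m (N k) by case: (projT2 (cid (sum k))).
have N_sum k : factors_through (N k) (col k L *m row k L') by case: (projT2 (cid (sum k))).
pose i k := projT1 (cid (N_sum k)); pose p k := projT1 (cid (projT2 (cid (N_sum k)))).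
apply: (null_retract (i := i) (p := p)) => // [|X s e x]; first exact: pmod_linear.
transitivity (\sum_k gen s ((col k L *m row k L') *m coord x)).
  by apply: eq_bigr => k _; apply: (projT2 (cid (projT2 (cid (N_sum k))))).
rewrite -(big_morph _ (@genD P X s) (@gen0 P X s)) -mulmx_suml -[RHS]genK; congr gen.
suff -> : \sum_k col k L *m row k L' = 1%:M by rewrite mul1mx.
rewrite -LL'; apply/matrixP => a b; rewrite summxE !mxE; apply: eq_bigr => k _.
by rewrite !mxE big_ord1 !mxE.
Qed.

Theorem proposition8p10 (a : Hcoh (reg T_Sigma) 3 (-1)) : edge a = 0.
Proof.
apply/hclass_eq0; exists 0; rewrite raddf0; apply/esym/dfunP => P.
exact/hclass_eq0/pmod_null/cycP.
Qed.
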